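(* Let $X$ be a real Banach space, let $n\geq 1$ and $K>1$, and let $q:X\to[0,+\infty)$ be a continuous $2n$-homogeneous polynomial such that $\|x\|^{2n}\leq q(x)\leq K\|x\|^{2n}$ for all $x\in X$. Then the function $Q:X\to[0,+\infty)$ defined by $$Q(x)=\left(1+q(x)\right)^{\frac{1}{2n}}-1$$ is real analytic, satisfies $\inf_{\|x\|\geq 1}Q(x)>0=Q(0)$, and is Lipschitz on all of $X$. Moreover, there is some $\delta_Q>0$ such that $Q$ has a holomorphic extension $\widetilde{Q}$ to the open strip $W_{\delta_Q}:=\{x+z: x\in X,\ z\in\widetilde{X},\ \|z\|_{\widetilde{X}}<\delta_Q\}$ in $\widetilde{X}$ such that $\widetilde{Q}$ is still Lipschitz on $W_{\delta_Q}$. Finally, $$Q(x)<4r\implies\|x\|<8r,\quad\text{for all } r\geq 1,\ x\in X.$$ In particular $Q(x)\geq\frac12\|x\|$ for $\|x\|\geq 8$, and $Q$ is separating.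
   Context: A continuous $k$-homogeneous polynomial on $X$ is a map $x\mapsto A(x,\dots,x)$ with $A:X^k\to\mathbb{R}$ continuous and $k$-multilinear. A function on $X$ is real analytic if near each point it is given by a convergent series of continuous homogeneous polynomials. $\widetilde{X}=X\oplus iX$ is the complexification of $X$, with norm $\|x+iy\|_{\widetilde{X}}=\sup_{0\leq\theta\leq 2\pi}\|\cos\theta\,x-\sin\theta\,y\|_X$. A function $Q:X\to[0,+\infty)$ is separating if $Q(0)=0$ and there exist $M,m>0$ such that $Q(x)\geq m\|x\|$ whenever $\|x\|\geq M$. *)

(* Defs.v *)
From HB Require Import structures.
From mathcomp Require Import all_boot all_order all_algebra.
From mathcomp Require Import all_classical all_reals all_analysis.
From mathcomp Require Import complex.
From mathcomp Require Import ring lra.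

Set Implicit Arguments.
Unset Strict Implicit.
Unset Printing Implicit Defensive.

Import Order.TTheory GRing.Theory Num.Theory.
Import numFieldNormedType.Exports.

Local Open Scope classical_set_scope.
Local Open Scope ring_scope.
Local Open Scope complex_scope.

Section Polynomials.
Context {R : realType} {X : completeNormedModType R}.

Definition multilinear (k : nat) (A : ('I_k -> X) -> R) : Prop :=
  forall (i : 'I_k) (v : 'I_k -> X),
    linear (fun x : X => A (fun j => if j == i then x else v j) : R^o).

(* [{ptws 'I_k -> X}] is X^k with the product topology. *)
Definition continuous_homogeneous_polynomial (k : nat) (P : X -> R) : Prop :=
  exists A : {ptws 'I_k -> X} -> R,
    [/\ multilinear A, continuous A & forall x, P x = A (fun=> x)].

(* Since X is complete, Baire's theorem turns pointwise convergence on a ball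
   into uniform convergence on a smaller ball with the same centre. *)
Definition real_analytic (f : X -> R) : Prop :=
  forall x : X, exists (P : nat -> X -> R) (r : R),
    [/\ 0 < r, forall k, continuous_homogeneous_polynomial k (P k) &
        forall h : X, `|h| < r -> series (fun k => P k h) @ \oo --> f (x + h)].

Definition separating (Q : X -> R) : Prop :=
  [/\ forall x, 0 <= Q x, Q 0 = 0 &
      exists M m : R, [/\ 0 < M, 0 < m &
        forall x, M <= `|x| -> m * `|x| <= Q x]].

End Polynomials.

(* The pair (x, y) stands for x + iy. The alias keeps the product norm and
   topology of [X * X] from being inferred. *)
Definition complexification (R : realType) (X : completeNormedModType R) : Type :=
  (X * X)%type.

Section Complexification.
Context {R : realType} {X : completeNormedModType R}.
Local Notation Xc := (complexification X).
Implicit Type z : Xc.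

HB.instance Definition _ := GRing.Zmodule.copy Xc (X * X)%type.

Definition complexification_scale (c : R[i]) (z : Xc) : Xc :=
  (complex.Re c *: z.1 - complex.Im c *: z.2,
   complex.Im c *: z.1 + complex.Re c *: z.2).

Local Fact scaleA a b z : complexification_scale a (complexification_scale b z)
  = complexification_scale (a * b) z.
Proof.
case: a b z => [a a'] [b b'] [x y]; rewrite /complexification_scale /=.
congr pair; rewrite scalerBr scalerDr !scalerA scalerBl scalerDl.
  by rewrite !opprD addrACA.
by rewrite addrACA [_ + a * b' *: x]addrC [_ + a * b *: y]addrC.
Qed.

Local Fact scale1 : left_id 1 complexification_scale.
Proof.
by case=> x y; rewrite /complexification_scale /= !scale1r !scale0r subr0 add0r.
Qed.

Local Fact scaleDr : right_distributive complexification_scale +%R.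
Proof.
move=> [a b] [x y] [x' y']; rewrite /complexification_scale /=.
by congr pair; rewrite /= !scalerDr ?opprD addrACA.
Qed.

Local Fact scaleDl z : {morph complexification_scale^~ z : a b / a + b}.
Proof.
case: z => x y [a a'] [b b']; rewrite /complexification_scale /=.
by congr pair; rewrite /= !scalerDl ?opprD addrACA.
Qed.

HB.instance Definition _ := GRing.Zmodule_isLmodule.Build R[i] Xc
  scaleA scale1 scaleDr scaleDl.

Definition taylor_norm (z : Xc) : R :=
  sup [set `|cos t *: z.1 - sin t *: z.2| | t in `[0, 2 * pi]].

Local Fact taylor_ubound z :
  has_sup [set `|cos t *: z.1 - sin t *: z.2| | t in `[(0 : R), 2 * pi]].
Proof.
split.
  exists `|cos (0 : R) *: z.1 - sin (0 : R) *: z.2|; exists 0 => //=.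
  by rewrite in_itv /= lexx mulr_ge0 // pi_ge0.
exists (`|z.1| + `|z.2|) => _ [t _ <-].
apply: (le_trans (ler_normB _ _)); rewrite !normrZ.
apply: lerD; rewrite ler_piMl // ler_norml.
  by rewrite cos_geN1 cos_le1.
by rewrite sin_geN1 sin_le1.
Qed.

Local Fact taylor_norm_ub z (u v : R) : u ^+ 2 + v ^+ 2 = 1 ->
  `|u *: z.1 - v *: z.2| <= taylor_norm z.
Proof.
move=> uv1; apply: ub_le_sup; first exact: (taylor_ubound z).2.
have u1 : -1 <= u <= 1.
  by rewrite -ler_norml -(@ler_pXn2r _ 2) ?nnegrE // expr1n real_normK ?num_real //;
    have := sqr_ge0 v; lra.
have p0 := pi_ge0 R; have := acos_lepi u1; have := acos_ge0 u1 => a0 ap.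
have sv : sin (acos u) = `|v|.
  by rewrite sin_acos // -sqrtr_sqr; congr Num.sqrt; lra.
have [v0|v0] := lerP 0 v.
  exists (acos u) => /=; first by rewrite in_itv /= a0; lra.
  by rewrite acosK ?in_itv // sv ger0_norm.
exists (2 * pi - acos u) => /=; first by rewrite in_itv /=; lra.
rewrite [2 * pi - _]addrC mulr_natl cosD2pi sinD2pi cosN sinN acosK ?in_itv //.
by rewrite sv ltr0_norm // opprK.
Qed.

Local Fact taylor_norm_le z (M : R) :
  (forall u v, u ^+ 2 + v ^+ 2 = 1 -> `|u *: z.1 - v *: z.2| <= M) ->
  taylor_norm z <= M.
Proof.
move=> H; apply: ge_sup; first exact: (taylor_ubound z).1.
by move=> _ [t _ <-]; apply: H; rewrite cos2Dsin2.
Qed.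

Local Fact taylor_norm_ge0 z : 0 <= taylor_norm z.
Proof.
by apply: le_trans (@taylor_norm_ub z 1 0 _); rewrite ?expr1n ?expr0n ?addr0.
Qed.

Definition complexification_norm (z : Xc) : R[i] := (taylor_norm z)%:C.

Local Fact taylor_normD (x y : Xc) :
  complexification_norm (x + y) <= complexification_norm x + complexification_norm y.
Proof.
rewrite /complexification_norm -rmorphD lecR; apply: taylor_norm_le => u v uv.
have -> : u *: (x + y).1 - v *: (x + y).2 =
  (u *: x.1 - v *: x.2) + (u *: y.1 - v *: y.2).
  by rewrite /= !scalerDr opprD addrACA.
by apply: (le_trans (ler_normD _ _)); apply: lerD; apply: taylor_norm_ub.
Qed.

Local Fact taylor_normZ_le (c : R[i]) z : c != 0 ->
  taylor_norm (c *: z) <= complex.Re `|c| * taylor_norm z.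
Proof.
move=> c0; have : 0 < `|c| by rewrite normr_gt0.
rewrite normc_def /=; case: c c0 => a b /= c0; rewrite ltcR.
set r := Num.sqrt _ => r0.
have r2 : r ^+ 2 = a ^+ 2 + b ^+ 2 by rewrite sqr_sqrtr // addr_ge0 // sqr_ge0.
apply: taylor_norm_le => u v uv.
have -> : u *: ((a +i* b) *: z).1 - v *: ((a +i* b) *: z).2 =
    (u * a - v * b) *: z.1 - (u * b + v * a) *: z.2.
  rewrite /= scalerBr scalerDr !scalerA scalerBl scalerDl.
  by rewrite !opprD addrACA.
have -> : (u * a - v * b) *: z.1 - (u * b + v * a) *: z.2 =
    r *: (((u * a - v * b) / r) *: z.1 - ((u * b + v * a) / r) *: z.2).
  by rewrite scalerBr !scalerA ![r * _]mulrC !divfK ?gt_eqF.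
rewrite normrZ gtr0_norm // ler_pM2l //; apply: taylor_norm_ub.
rewrite !expr_div_n -mulrDl r2.
have -> : (u * a - v * b) ^+ 2 + (u * b + v * a) ^+ 2 =
  (u ^+ 2 + v ^+ 2) * (a ^+ 2 + b ^+ 2) by ring.
by rewrite uv mul1r divff // -r2 expf_neq0 // gt_eqF.
Qed.

Local Fact taylor_normZ (c : R[i]) z :
  complexification_norm (c *: z) = `|c| * complexification_norm z.
Proof.
rewrite /complexification_norm.
have -> : `|c| = (complex.Re `|c|)%:C by rewrite normc_def.
rewrite -rmorphM; congr (_%:C).
have [->|c0] := eqVneq c 0.
  rewrite normr0 /= mul0r scale0r; apply: le_anti; rewrite taylor_norm_ge0 andbT.
  by apply: taylor_norm_le => u v _ /=; rewrite !scaler0 subrr normr0.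
apply: le_anti; rewrite taylor_normZ_le //=.
have := @taylor_normZ_le c^-1 (c *: z).
rewrite invr_eq0 scalerA mulVf // scale1r => /(_ c0).
have n0 : 0 < complex.Re `|c|.
  by move: c0; rewrite -normr_gt0 normc_def /= ltcR.
have -> : complex.Re `|c^-1| = (complex.Re `|c|)^-1.
  rewrite normfV; have -> : `|c| = (complex.Re `|c|)%:C by rewrite normc_def.
  by rewrite -fmorphV.
by rewrite ler_pdivlMl.
Qed.

Local Fact taylor_norm0_eq0 z : complexification_norm z = 0 -> z = 0.
Proof.
rewrite /complexification_norm => -[N0].
have := @taylor_norm_ub z 1 0; have := @taylor_norm_ub z 0 1.
rewrite N0 !expr1n !expr0n /= add0r addr0 => /(_ erefl) + /(_ erefl).
rewrite !scale1r !scale0r sub0r subr0 normrN !normr_le0.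
by case: z {N0} => x y /= /eqP -> /eqP ->.
Qed.

HB.instance Definition _ := Lmodule_isNormed.Build R[i] Xc
  taylor_normD taylor_normZ taylor_norm0_eq0.

Definition complexify (x : X) : Xc := (x, 0).

Definition strip (delta : R) : set Xc :=
  [set w | exists (x : X) (z : Xc), `|z| < delta%:C /\ w = complexify x + z].

(* [differentiable] is Frechet differentiability over the scalar field R[i]. *)
Definition holomorphic_on (U : set Xc) (f : Xc -> R[i]^o) : Prop :=
  open U /\ forall z, U z -> differentiable f z.

End Complexification.

(* Main.v *)
Require Import Defs.
From HB Require Import structures.
From mathcomp Require Import all_boot all_order all_algebra.
From mathcomp Require Import all_classical all_reals all_analysis.
From mathcomp Require Import complex.
From mathcomp Require Import ring lra zify.

Set Implicit Arguments.
Unset Strict Implicit.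
Unset Printing Implicit Defensive.

Import Order.TTheory GRing.Theory Num.Theory.
Import numFieldNormedType.Exports.

Local Open Scope classical_set_scope.
Local Open Scope ring_scope.
Local Open Scope complex_scope.
(** Write [N = 2 n] and [q x = A (x, ..., x)] with [A] multilinear and
    continuous.  Everything about [q] is read off from one expansion,
    [multilinearD]: [A (u + v)] is the sum, over the sets [S] of slots, of the
    value of [A] at the tuple with [u] on [S] and [v] off [S].

    Analyticity ([power_analytic]).  For fixed [x] and [h], the expansion makes
    [t |-> 1 + q (x + t h)] a polynomial [Y] whose [i]-th coefficient is a
    continuous [i]-homogeneous polynomial of [h].  The power [f = Y ^ al] solves
    [Y f' = al Y' f], and this equation determines its Taylor coefficients by a
    linear recursion ([powcoef]).  The recursion shows at once that the [k]-th
    coefficient is a continuous [k]-homogeneous polynomial of [h] and that, for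
    small [h], it is at most a constant times [2 ^- k].  The Taylor polynomial
    [F] of degree [m] then solves the equation up to a term of order
    [(3 / 4) ^ m], and the mean value theorem applied to [F Y ^ - al] on
    [[0, 1]] gives the convergence of the series to [Y(1) ^ al]
    ([powcoef_series_cvg]), without any theory of power series.

    Holomorphic extension ([holomorphic_root_extension]).  Giving the value
    [i ^ |S| A (y on S, x off S)] to each term of the expansion of
    [A (x + i y)] extends [q] to a function [f] on the complexification.  It is
    the diagonal of a complex multilinear map, hence is differentiable, and
    [|f (z + h) - f z| <= C |h| M ^ (N - 1)] when [|z|, |h| <= M].  Since
    [1 + q x >= 1 + |x| ^ N] is comparable to [(1 + |x|) ^ N], on a thin strip
    [1 + f] differs from [1 + q x] by at most half of it: it stays in the right
    half-plane and [|1 + f w| >= c (1 + |w|) ^ N].  So the principal root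
    [croot] can be composed with [1 + f].  If [al], [be] are the principal
    roots of [a], [b], then
    [a - b = (al - be) (al ^ (N-1) + al ^ (N-2) be + ... + be ^ (N-1))], where
    the second factor has modulus at least [kappa |al| ^ (N - 1)], because its
    terms lie in a common sector ([root_sum_ge]).  This yields the derivative
    of [croot], and also the Lipschitz estimate on the strip: the growth
    [(1 + |w|) ^ (N - 1)] of the increments of [f] is exactly compensated by
    that of [|al| ^ (N - 1)].

    The real Lipschitz estimate is the restriction of the complex one, and the
    growth statements all follow from [|x| - 1 <= Q x]. *)

Import ComplexField.Normc.

Local Arguments normc : simpl never.

(** * Multilinear maps *)

Lemma sum_subsets_setU1 (I : finType) (V : nmodType) (D : {set I}) (j : I)
    (F : {set I} -> V) : j \notin D ->
  \sum_(S : {set I} | S \subset j |: D) F S =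
  \sum_(S : {set I} | S \subset D) (F S + F (j |: S)%SET).
Proof.
move=> jD.
rewrite (bigID (fun S : {set I} => j \in S)) /= addrC big_split /=.
have notin (S : {set I}) : S \subset D -> j \notin S.
  by move=> /fintype.subsetP SD; apply: contra jD => /SD.
congr (_ + _).
  apply: eq_bigl => S; apply/andP/idP => [[SD jS]|SD].
    apply/fintype.subsetP => i iS; move/fintype.subsetP: SD => /(_ i iS).
    by rewrite in_setU1 => /orP[/eqP ij|//]; rewrite -ij iS in jS.
  by split; [exact: fintype.subset_trans SD (finset.subsetUr _ _)|exact: notin].
rewrite (reindex_onto (fun S : {set I} => j |: S)%SET
                      (fun S : {set I} => S :\ j)%SET) /=.
  apply: eq_bigl => S; rewrite finset.setU11 andbT.
  apply/andP/idP => [[SD /eqP <-]|SD].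
    by rewrite finset.subDset.
  by rewrite finset.setUS //= finset.setU1K // notin.
by move=> S /andP[_ jS]; rewrite finset.setD1K.
Qed.

Definition slot N (T : Type) (v : 'I_N -> T) (i : 'I_N) (x : T) : 'I_N -> T :=
  fun j => if j == i then x else v j.

Definition mixed N (T : Type) (S : {set 'I_N}) (u v : 'I_N -> T) : 'I_N -> T :=
  fun j => if j \in S then u j else v j.

Section Multilinear.
Context {R : comPzRingType} {X : lmodType R} {W : lmodType R} {N : nat}.
Implicit Types (A : ('I_N -> X) -> W) (u v : 'I_N -> X).

(** Stated for an arbitrary ring of scalars: it is used for real tuples and for
    tuples in the complexification. *)
Definition slotwise_linear A := forall i v, linear (fun x => A (slot v i x)).

Variable A : ('I_N -> X) -> W.
Hypothesis linA : slotwise_linear A.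

Lemma slotD v i x y : A (slot v i (x + y)) = A (slot v i x) + A (slot v i y).
Proof. by have := linA i v 1 x y; rewrite !scale1r. Qed.

Lemma slot0 v i : A (slot v i 0) = 0.
Proof. by apply: (addIr (A (slot v i 0))); rewrite -slotD addr0 add0r. Qed.

Lemma slotZ v i a x : A (slot v i (a *: x)) = a *: A (slot v i x).
Proof. by have := linA i v a x 0; rewrite slot0 !addr0. Qed.

Lemma mixed_setU1 (S : {set 'I_N}) i u v :
  mixed (i |: S)%SET u v = slot (mixed S u v) i (u i).
Proof.
by apply/funext => j; rewrite /mixed /slot in_setU1; case: eqVneq => //= ->.
Qed.

(** The sum is opened in one slot at a time.  The induction is on the set [D] of
    the slots already opened, the other ones being filled by an arbitrary
    [w]; opening slot [i] splits the subsets of [D] according to whether they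
    contain [i] ([sum_subsets_setU1]). *)
Lemma multilinearD u v :
  A (fun j => u j + v j) = \sum_(S : {set 'I_N}) A (mixed S u v).
Proof.
suff H (D : {set 'I_N}) w :
    A (mixed D (fun j => u j + v j) w) =
    \sum_(S : {set 'I_N} | S \subset D) A (mixed D (mixed S u v) w).
  transitivity (A (mixed [set: 'I_N]%SET (fun j => u j + v j) u)).
    by congr A; apply/funext => j; rewrite /mixed inE.
  rewrite H; under eq_bigl do rewrite finset.subsetT.
  by apply: eq_bigr => S _; congr A; apply/funext => j; rewrite /mixed inE.
have [k] := ubnP #|D|; elim: k => // k IH in D w *; rewrite ltnS => Dk.
have [->|[i iD]] := set_0Vmem D.
  under eq_bigl do rewrite finset.subset0.
  by rewrite big_pred1_eq; congr A; apply/funext => j; rewrite /mixed inE.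
have Di : (#|D :\ i| < k)%N by rewrite (leq_trans _ Dk) // [ltnRHS](cardsD1 i) iD.
have iDi : i \notin (D :\ i)%SET by rewrite !inE eqxx.
have mixedE u' x : mixed (D :\ i)%SET u' (slot w i x) =
    slot (mixed (D :\ i)%SET u' w) i x.
  by apply/funext => j; rewrite /mixed /slot !inE; case: eqVneq.
rewrite -(finset.setD1K iD) mixed_setU1 slotD -!mixedE !IH // -big_split sum_subsets_setU1 //=.
apply: eq_bigr => S SD; rewrite addrC.
have iS : i \notin S by apply: contra iDi; exact/fintype.subsetP.
congr (A _ + A _); apply/funext => j; rewrite /mixed /slot !inE;
  by case: eqVneq => [->|_] //=; rewrite ?(negbTE iS).
Qed.

Lemma multilinearZ (c : 'I_N -> R) v :
  A (fun j => c j *: v j) = (\prod_j c j) *: A v.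
Proof.
suff H (s : seq 'I_N) : uniq s ->
    A (fun j => if j \in s then c j *: v j else v j) = (\prod_(j <- s) c j) *: A v.
  rewrite -H ?index_enum_uniq //; congr A; apply/funext => j.
  by rewrite mem_index_enum.
elim: s => [|i s IH]; first by rewrite big_nil scale1r.
rewrite /= => /andP[ins us]; rewrite big_cons -scalerA -IH //.
set w := fun j => if j \in s then _ else _.
have -> : w = slot w i (v i).
  by apply/funext => j; rewrite /slot /w; case: eqVneq => // ->; rewrite (negbTE ins).
rewrite -slotZ; congr A; apply/funext => j.
by rewrite /slot /w inE; case: eqVneq => // ->.
Qed.

End Multilinear.

(** The product topology is a supremum of initial topologies. *)
Lemma ptws_cvg (I : Type) (T : topologicalType) (F : set_system (I -> T))
    (f : {ptws I -> T}) : Filter F ->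
  (forall i, (fun g => g i) @ F --> f i) -> F --> f.
Proof.
move=> FF cF; apply/cvg_sup => i U [V [[W oW WV] Vf] VU].
apply: filterS VU _; rewrite -WV; apply: (cF i).
by apply: open_nbhs_nbhs; split => //; move: Vf; rewrite -WV.
Qed.

Lemma ptws_continuous (S : topologicalType) (I : Type) (T : topologicalType)
    (g : S -> {ptws I -> T}) :
  (forall i, continuous (fun s => g s i)) -> continuous g.
Proof. by move=> cg s; apply: ptws_cvg => i; exact: (cg i s). Qed.

Lemma ptws_proj (I : eqType) (T : topologicalType) (i : I) :
  continuous (fun f : {ptws I -> T} => f i).
Proof. exact: (@proj_continuous I (fun=> T) i). Qed.

Section BoundedMultilinear.
Context {R : realType} {X : completeNormedModType R} {N : nat}.
Variable A : {ptws 'I_N -> X} -> R.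
Hypotheses (linA : multilinear A) (contA : continuous A).

Lemma multilinear_slotwise : slotwise_linear (A : ('I_N -> X) -> R^o).
Proof. exact: linA. Qed.

(** [A] is bounded by some [B] on a box [|v j| < e], because such boxes generate
    a filter converging to 0; rescaling each slot separately then gives the
    bound for all radii. *)
Lemma multilinear_bounded : exists2 C : R, 0 < C &
  forall (v : 'I_N -> X) (M : 'I_N -> R),
    (forall j, 0 < M j) -> (forall j, `|v j| <= M j) -> `|A v| <= C * \prod_j M j.
Proof.
pose F : set_system ('I_N -> X) := [set B | exists2 e : R, 0 < e &
  forall v : 'I_N -> X, (forall j, `|v j| < e) -> B v].
have FF : Filter F.
  constructor; first by exists 1.
    move=> P Q [e e0 eP] [d d0 dQ]; exists (Num.min e d) => [|v vlt].
      by rewrite lt_min e0.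
    split; [apply: eP => j|apply: dQ => j];
      by have := vlt j; rewrite lt_min => /andP[].
  by move=> P Q PQ [e e0 eP]; exists e => // v /eP /PQ.
have F0 : F --> ((fun=> 0) : {ptws 'I_N -> X}).
  apply: ptws_cvg => j U /= /nbhs_norm0P [e /= e0 eU]; exists e => // v ve.
  by rewrite /preimage /=; apply: eU => /=; exact: ve.
have cAF : A @ F --> A (fun=> 0) by apply: (cvg_comp _ _ F0); exact: contA.
have : (A @ F) (ball (A (fun=> 0)) 1) by apply: cAF; exact: nbhsx_ballx.
case=> e e0 /= eA; pose d := e / 2; have d0 : 0 < d by rewrite divr_gt0.
pose B := `|A (fun=> 0)| + 1; have B0 : 0 < B by rewrite ltr_wpDl.
exists (B * d^-1 ^+ N); first by rewrite mulr_gt0 // exprn_gt0 // invr_gt0.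
move=> v M M0 vM.
have -> : v = fun j => (M j / d) *: ((M j / d)^-1 *: v j).
  by apply/funext => j; rewrite scalerA divff ?scale1r // gt_eqF // divr_gt0.
rewrite (multilinearZ multilinear_slotwise) normrM normr_prod.
have -> : \prod_j `|M j / d| = d^-1 ^+ N * \prod_j M j.
  rewrite -[X in d^-1 ^+ X](card_ord N) -prodr_const -big_split /=.
  by apply: eq_bigr => j _; rewrite gtr0_norm ?divr_gt0 // mulrC.
rewrite -[leRHS]mulrA [leRHS]mulrC ler_pM2l; last first.
  by rewrite mulr_gt0 ?exprn_gt0 ?invr_gt0 // prodr_gt0.
(* The rescaled tuple has norms at most d = e / 2, hence is in the box. *)
have := eA (fun j => (M j / d)^-1 *: v j).
rewrite /ball /= => /(_ _)/ltW H; rewrite /B.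
rewrite -lerBlDl (le_trans (lerB_dist _ _)) // distrC H // => j.
rewrite normrZ gtr0_norm ?invr_gt0 ?divr_gt0 // invf_div.
rewrite mulrAC ltr_pdivrMr // mulrC.
have : d < e by rewrite /d; lra.
have := vM j; have := M0 j; nra.
Qed.

End BoundedMultilinear.

(** * Continuous homogeneous polynomials *)

Section HomogeneousPolynomials.
Context {R : realType} {X : completeNormedModType R}.
Local Notation chp := (@continuous_homogeneous_polynomial R X).

Lemma homogeneous_cst (c : R) : chp 0 (fun=> c).
Proof.
exists (fun=> c); split => //; first by case.
exact: cst_continuous.
Qed.

Lemma homogeneous0 k : chp k (fun=> 0).
Proof.
exists (fun=> 0); split => //; last exact: cst_continuous.
by move=> i v a x y /=; rewrite scaler0 addr0.
Qed.

Lemma homogeneousD k P Q : chp k P -> chp k Q -> chp k (fun x => P x + Q x).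
Proof.
move=> [A [lA cA PA]] [B [lB cB QB]]; exists (fun v => A v + B v); split.
- by move=> i v a x y /=; rewrite lA lB scalerDr addrACA.
- by move=> v; apply: continuousD; [exact: cA|exact: cB].
- by move=> x; rewrite PA QB.
Qed.

Lemma homogeneousM k l P Q : chp k P -> chp l Q -> chp (k + l) (fun x => P x * Q x).
Proof.
move=> [A [lA cA PA]] [B [lB cB QB]].
exists (fun v => A (fun i => v (lshift l i)) * B (fun j => v (rshift k j))); split.
- move=> i v a x y /=; case: (split_ordP i) => m ->.
    have E z : (fun i0 => if lshift l i0 == lshift l m then z else v (lshift l i0)) =
               (fun i0 => if i0 == m then z else v (lshift l i0)).
      by apply/funext => i0; rewrite eq_lshift.
    have E' z : (fun j => if rshift k j == lshift l m then z else v (rshift k j)) =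
               (fun j => v (rshift k j)).
      by apply/funext => i0; rewrite eq_rlshift.
    by rewrite !E !E' lA mulrDl scalerAl.
  have E z : (fun i0 => if lshift l i0 == rshift k m then z else v (lshift l i0)) =
             (fun i0 => v (lshift l i0)).
    by apply/funext => i0; rewrite eq_lrshift.
  have E' z : (fun j => if rshift k j == rshift k m then z else v (rshift k j)) =
             (fun j => if j == m then z else v (rshift k j)).
    by apply/funext => i0; rewrite eq_rshift.
  by rewrite !E !E' lB mulrDr scalerAr.
- have cl : continuous (fun v : {ptws 'I_(k + l) -> X} =>
      (fun i => v (lshift l i)) : {ptws 'I_k -> X}).
    by apply: ptws_continuous => i; exact: ptws_proj.
  have cr : continuous (fun v : {ptws 'I_(k + l) -> X} =>
      (fun i => v (rshift k i)) : {ptws 'I_l -> X}).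
    by apply: ptws_continuous => i; exact: ptws_proj.
  move=> v; apply: continuousM.
    by apply: (continuous_comp (cl v)); exact: cA.
  by apply: (continuous_comp (cr v)); exact: cB.
- by move=> x; rewrite PA QB.
Qed.

Lemma homogeneous_sum k (I : Type) (r : seq I) (S : pred I) (P : I -> X -> R) :
  (forall i, S i -> chp k (P i)) -> chp k (fun x => \sum_(i <- r | S i) P i x).
Proof.
move=> PP; elim: r => [|i r IH].
  by under eq_fun do rewrite big_nil; exact: homogeneous0.
under eq_fun do rewrite big_cons.
by case: (boolP (S i)) => [/PP Pi|_ //]; exact: homogeneousD.
Qed.

(** Freezing the slots off [S] at [x] gives a multilinear map of the slots in
    [S], which have to be renumbered by ['I_#|S|]: slot [j] gets the number
    [index j (enum S)], and [insub] returns [None] exactly for the frozen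
    slots. *)
Lemma homogeneous_mixed N (A : {ptws 'I_N -> X} -> R) (S : {set 'I_N}) (x : X) :
  multilinear A -> continuous A ->
  chp #|S| (fun h => A (mixed S (fun=> h) (fun=> x))).
Proof.
move=> lA cA.
pose rank (j : 'I_N) : option 'I_#|S| := insub (index j (enum S)).
pose ext (v : 'I_#|S| -> X) : 'I_N -> X := fun j => oapp v x (rank j).
have ltE j : (index j (enum S) < #|S|)%N = (j \in S).
  by rewrite cardE index_mem mem_enum.
have rankP j : (rank j : bool) = (j \in S).
  by rewrite /rank -ltE; case: insubP => [u -> _|/negbTE ->].
have rank_val i : rank (enum_val i) = Some i.
  rewrite /rank; case: insubP => [u _ E|]; last by rewrite ltE enum_valP.
  congr Some; apply: val_inj; rewrite E /= (enum_val_nth (enum_val i)).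
  by rewrite index_uniq ?enum_uniq // -cardE.
have val_rank j i : rank j = Some i -> j = enum_val i.
  rewrite /rank; case: insubP => // u lt E [<-].
  by rewrite (enum_val_nth j) E nth_index // mem_enum -ltE.
exists (fun v => A (ext v)); split.
- move=> i v a y z /=.
  have E w : ext (fun j => if j == i then w else v j) =
      (fun j => if j == enum_val i then w else ext v j).
    apply/funext => j; rewrite /ext; case: eqVneq => [->|ji].
      by rewrite rank_val /= eqxx.
    case: (rank j) (val_rank j) => //= i' /(_ _ erefl) ji'.
    by case: eqVneq => // E; rewrite ji' E eqxx in ji.
  by rewrite !E lA.
- have ce : continuous (ext : {ptws 'I_#|S| -> X} -> {ptws 'I_N -> X}).
    apply: ptws_continuous => j; rewrite /ext; case: (rank j) => [i|] /=.
      exact: ptws_proj.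
    exact: cst_continuous.
  by move=> v; apply: (continuous_comp (ce v)); exact: cA.
- move=> h; congr A; apply/funext => j; rewrite /mixed /ext.
  by rewrite -rankP; case: (rank j).
Qed.

End HomogeneousPolynomials.

(** * Taylor series of a power of a polynomial *)

Section PowerOfPolynomial.
Context {R : realType}.
Implicit Types (al a : R) (p : nat -> R) (k : nat).

(** Comparing the coefficients of [t ^ (k - 1)] in [Y f' = al Y' f], with [p] the
    coefficients of [Y], [a = p 0] and [c] those of [f], gives
    [a k c_k = \sum_(j < k) (al (k - j) - j) p_(k - j) c_j].  The recursion needs
    all the previous values, hence the list.  The constant [a] is a separate
    argument because the recursion is used with [p] depending on a vector and
    [p 0] constant. *)
Fixpoint powcoefs al a p k : seq R :=
  if k is k'.+1 then
    let s := powcoefs al a p k' in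
    rcons s ((a * k%:R)^-1 *
      \sum_(j < k) (al * (k - j)%:R - j%:R) * (p (k - j)%N * s`_j))
  else [:: a `^ al].

Definition powcoef al a p k := (powcoefs al a p k)`_k.

Lemma size_powcoefs al a p k : size (powcoefs al a p k) = k.+1.
Proof. by elim: k => //= k IH; rewrite size_rcons IH. Qed.

Lemma nth_powcoefs al a p k j : (j <= k)%N ->
  (powcoefs al a p k)`_j = powcoef al a p j.
Proof.
elim: k => [|k IH]; first by rewrite leqn0 => /eqP ->.
rewrite leq_eqVlt => /orP[/eqP -> //|jk].
by rewrite /= nth_rcons size_powcoefs jk IH.
Qed.

Lemma powcoef0 al a p : powcoef al a p 0 = a `^ al.
Proof. by []. Qed.

Lemma powcoefS al a p k : powcoef al a p k.+1 = (a * k.+1%:R)^-1 *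
  \sum_(j < k.+1) (al * (k.+1 - j)%:R - j%:R) * (p (k.+1 - j)%N * powcoef al a p j).
Proof.
rewrite [LHS]/powcoef /= nth_rcons size_powcoefs ltnn eqxx.
congr (_ * _); apply: eq_bigr => j _.
by rewrite nth_powcoefs // -ltnS.
Qed.

Lemma sum_half_pow k : \sum_(j < k) (2^-1 : R) ^+ (k - j) = 1 - 2^-1 ^+ k.
Proof.
elim: k => [|k IH]; first by rewrite big_ord0 expr0 subrr.
rewrite big_ord_recr /= subSnn expr1.
under eq_bigr do rewrite subSn ?(ltnW (ltn_ord _)) // exprS.
by rewrite -mulr_sumr IH exprS; lra.
Qed.

(** The factor [k] comes from the derivatives in the differential equation. *)
Lemma half_pow_le k : k%:R * (2^-1 : R) ^+ k <= 2 * (3 / 4) ^+ k.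
Proof.
have -> : (3 / 4 : R) = 3 / 2 * 2^-1 by lra.
rewrite exprMn mulrA ler_pM2r ?exprn_gt0 //.
elim: k => [|k IH]; first by rewrite expr0; lra.
rewrite exprS mulrCA.
have : (1 : R) <= (3 / 2) ^+ k by rewrite exprn_ege1 //; lra.
rewrite -[k.+1%:R]natr1; move: IH; set u := _ ^+ _.
lra.
Qed.

Variables (al : R) (Y : {poly R}).
Local Notation a := Y`_0.
Local Notation c := (powcoef al a (nth 0 Y)).
Hypotheses (al0 : 0 <= al) (al1 : al <= 1) (a0 : 0 < a).
Hypothesis Ysmall : forall i, `|Y`_i| <= a / 4 ^+ i.

Lemma weight_le (k j : nat) : (j <= k)%N -> `|al * (k - j)%:R - j%:R| <= k%:R.
Proof.
move=> jk; rewrite natrB // ler_norml.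
have k0 : (j%:R : R) <= k%:R by rewrite ler_nat.
have j0 : (0 : R) <= j%:R by [].
move: k0 j0; set x := j%:R; set y := k%:R => xy x0.
have : al * (y - x) <= y - x by rewrite ler_piMl // subr_ge0.
have : 0 <= al * (y - x) by rewrite mulr_ge0 // subr_ge0.
by move=> *; lra.
Qed.

Lemma term_le (k j : nat) (f : R) : (j <= k)%N ->
  `|f| <= a `^ al / 2 ^+ j ->
  `|(al * (k - j)%:R - j%:R) * (Y`_(k - j) * f)| <=
  k%:R * (a * a `^ al) * 2^-1 ^+ k * 2^-1 ^+ (k - j).
Proof.
move=> jk fle; rewrite !normrM -!mulrA; apply: ler_pM => //.
  exact: weight_le.
apply: (le_trans (ler_pM _ _ (Ysmall _) fle)) => //.
rewrite -{2}(subnK jk) exprD -!exprVn.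
have -> : (4 : R)^-1 = 2^-1 * 2^-1 by lra.
by rewrite exprMn; set u := _ ^+ _; set v := _ ^+ _; set w := _ `^ _; nra.
Qed.

(** The weight [al (k - j) - j] is at most [k] in absolute value, which absorbs
    the division by [k]; the convolution of [4 ^- i] with [2 ^- j] is then at
    most [2 ^- k]. *)
Lemma powcoef_le k : `|c k| <= a `^ al / 2 ^+ k.
Proof.
have [m] := ubnP k; elim: m => // m IH in k *; rewrite ltnS => km.
case: k => [|k] in km *.
  by rewrite powcoef0 expr0 divr1 ger0_norm // powR_ge0.
rewrite powcoefS normrM gtr0_norm ?invr_gt0 ?mulr_gt0 //.
rewrite mulrC ler_pdivrMr ?mulr_gt0 //.
apply: (le_trans (ler_norm_sum _ _ _)).
apply: (@le_trans _ _ (\sum_(j < k.+1)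
    k.+1%:R * (a * a `^ al) * 2^-1 ^+ k.+1 * 2^-1 ^+ (k.+1 - j))).
  apply: ler_sum => j _; apply: term_le; first exact: ltnW.
  by apply: IH; rewrite (leq_trans (ltn_ord j)).
rewrite -mulr_sumr sum_half_pow -exprVn.
have : 0 <= (2^-1 : R) ^+ k.+1 by rewrite exprn_ge0.
have : 0 <= k.+1%:R * (a * a `^ al) * (2^-1 : R) ^+ k.+1.
  by rewrite !mulr_ge0 ?powR_ge0 // ?exprn_ge0 // ltW.
set u := _ ^+ _ => u0; set w := _ `^ _; set v := k.+1%:R * _ * u => v0.
have -> : w * u * (a * k.+1%:R) = v by rewrite /v; ring.
by rewrite ler_piMr //; lra.
Qed.

Definition partial_poly m : {poly R} := \poly_(k < m.+1) c k.

Lemma partial_poly_coef_le m l : `|(partial_poly m)`_l| <= a `^ al / 2 ^+ l.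
Proof.
rewrite coef_poly; case: ifP => _; first exact: powcoef_le.
by rewrite normr0 divr_ge0 ?powR_ge0 ?exprn_ge0.
Qed.

(** The error made by the Taylor polynomial in [Y f' = al Y' f]. *)
Definition residual m :=
  Y * (partial_poly m)^`() - al *: (Y^`() * partial_poly m).

Lemma coef_residual m j : (residual m)`_j =
  - \sum_(l < j.+2) (al * (j.+1 - l)%:R - l%:R) * (Y`_(j.+1 - l) * (partial_poly m)`_l).
Proof.
rewrite /residual coefB coefZ !coefMr.
set F := partial_poly m.
have -> : \sum_(l < j.+1) Y`_(j - l) * F^`()`_l =
    \sum_(l < j.+2) l%:R * (Y`_(j.+1 - l) * F`_l).
  rewrite [RHS]big_ord_recl mul0r add0r; apply: eq_bigr => l _.
  by rewrite lift0 subSS coef_deriv mulrnAr [RHS]mulr_natl.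
have -> : \sum_(l < j.+1) Y^`()`_(j - l) * F`_l =
    \sum_(l < j.+2) (j.+1 - l)%:R * (Y`_(j.+1 - l) * F`_l).
  rewrite [RHS]big_ord_recr /= subnn mul0r addr0; apply: eq_bigr => l _.
  have lj : (l <= j)%N by rewrite -ltnS.
  by rewrite coef_deriv subSn // !mulrnAl mul1r.
rewrite mulr_sumr -sumrN -big_split /= -sumrN; apply: eq_bigr => l _.
by ring.
Qed.

(** In degree [j < m] the vanishing of this coefficient is exactly the recursion
    [powcoefS]. *)
Lemma coef_residual_eq0 m j : (j < m)%N -> (residual m)`_j = 0.
Proof.
move=> jm; rewrite coef_residual big_ord_recr /= subnn mulr0 sub0r.
rewrite [(partial_poly m)`_j.+1]coef_poly ltnS jm powcoefS.
under eq_bigr => l _.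
  rewrite [(partial_poly m)`_l]coef_poly (leq_trans (ltn_ord l)) ?ltnS ?(ltnW jm) //.
  over.
set S := \sum_(_ < _) _; apply/eqP; rewrite oppr_eq0 addr_eq0; apply/eqP.
by field; rewrite addrC natr1 pnatr_eq0 /= gt_eqF.
Qed.

Lemma coef_residual_le m j :
  `|(residual m)`_j| <= 4 * (a * a `^ al) * (3 / 4) ^+ j.+1.
Proof.
rewrite coef_residual normrN.
apply: (le_trans (ler_norm_sum _ _ _)).
apply: (@le_trans _ _ (\sum_(l < j.+2)
    j.+1%:R * (a * a `^ al) * 2^-1 ^+ j.+1 * 2^-1 ^+ (j.+1 - l))).
  apply: ler_sum => l _; apply: term_le; first by rewrite -ltnS.
  exact: partial_poly_coef_le.
rewrite -mulr_sumr big_ord_recr /= subnn expr0 sum_half_pow.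
have := half_pow_le j.+1.
have : 0 <= (2^-1 : R) ^+ j.+1 by rewrite exprn_ge0.
have : 0 <= a * a `^ al by rewrite mulr_ge0 ?powR_ge0 // ltW.
have : 0 <= j.+1%:R * (2^-1 : R) ^+ j.+1 by rewrite mulr_ge0 // exprn_ge0.
set u := _ ^+ _; set v := _ ^+ _; set w := a * _; set x := _.+1%:R.
move=> xu w0 u0 xuv.
have -> : x * w * u * (1 - u + 1) = w * ((x * u) * (2 - u)) by ring.
have -> : 4 * w * v = w * (4 * v) by ring.
by rewrite ler_wpM2l //; nra.
Qed.

(** Only the coefficients of degrees [m] to [m + size Y - 1] can be nonzero, so
    their number is bounded independently of [m]. *)
Lemma residual_le m (t : R) : 0 <= t <= 1 ->
  `|(residual m).[t]| <= (size Y)%:R * (4 * (a * a `^ al)) * (3 / 4) ^+ m.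
Proof.
move=> /andP[t0 t1].
have sF : (size (partial_poly m) <= m.+1)%N by rewrite size_poly.
have dsize (p : {poly R}) : (size p^`() <= (size p).-1)%N := size_poly _ _.
have sres : (size (residual m) <= m + size Y)%N.
  rewrite /residual (leq_trans (size_polyD _ _)) // geq_max size_polyN.
  apply/andP; split.
    apply: (leq_trans (size_polyMleq _ _)).
    by have := dsize (partial_poly m); move: sF; lia.
  apply: (leq_trans (size_scale_leq _ _)); apply: (leq_trans (size_polyMleq _ _)).
  have := dsize Y.
  have : (0 < size Y)%N.
    by rewrite lt0n size_poly_eq0; apply: contraTneq a0 => ->; rewrite coef0 ltxx.
  move: (size (partial_poly m)) sF (size Y^`()) (size Y) => f Ff d s; lia.
rewrite (horner_coef_wide _ sres) big_split_ord /= big1 ?add0r => [|i _]; last first.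
  by rewrite coef_residual_eq0 ?mul0r.
apply: (le_trans (ler_norm_sum _ _ _)).
rewrite -mulrA -[X in X%:R * _]card_ord mulr_natl -sumr_const.
apply: ler_sum => i _; rewrite normrM.
rewrite -[leRHS]mulr1; apply: ler_pM => //.
  apply: (le_trans (coef_residual_le _ _)).
  rewrite ler_wpM2l ?mulr_ge0 ?powR_ge0 ?(ltW a0) //.
  by apply: ler_wiXn2l; [lra|lra|lia].
by rewrite normrX ger0_norm // exprn_ile1.
Qed.

Hypothesis Yge1 : forall t : R, 0 <= t <= 1 -> 1 <= Y.[t].

(** Constant if [partial_poly m] were exactly [Y ^ al]. *)
Let G m (t : R) := (partial_poly m).[t] * Y.[t] `^ (- al).

Let Y_gt0 (t : R) : 0 <= t <= 1 -> 0 < Y.[t].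
Proof. by move=> /Yge1; exact: lt_le_trans. Qed.

Let G_derive m (t : R) : 0 <= t <= 1 ->
  is_derive t 1 (G m) ((residual m).[t] * Y.[t] `^ (- al - 1)).
Proof.
move=> t01; have Yt := Y_gt0 t01.
have dP := is_derive1_comp (is_derive1_powR (- al) Yt) (is_derive_poly Y t).
have dG := is_deriveM (is_derive_poly (partial_poly m) t) dP.
have PE : Y.[t] `^ (- al) = Y.[t] `^ (- al - 1) * Y.[t].
  rewrite -{3}[Y.[t]]powRr1 ?ltW // -powRD ?subrK //.
  by apply/implyP => _; rewrite gt_eqF.
apply: (is_derive_eq dG).
change ((partial_poly m).[t] * (- al * Y.[t] `^ (- al - 1) * Y^`().[t]) +
  Y.[t] `^ (- al) * (partial_poly m)^`().[t] =
  (residual m).[t] * Y.[t] `^ (- al - 1)).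
by rewrite PE /residual hornerD hornerN hornerZ !hornerM; ring.
Qed.

(** [G m] equals 1 at 0 and its derivative tends uniformly to 0 on [[0, 1]], the
    factor [Y ^ (- al - 1)] being at most 1 because [1 <= Y]. *)
Lemma partial_poly_cvg : (fun m => (partial_poly m).[1]) @ \oo --> Y.[1] `^ al.
Proof.
pose B := (size Y)%:R * (4 * (a * a `^ al)).
have G0 m : G m 0 = 1.
  rewrite /G !horner_coef0 coef_poly powcoef0 powRN divff //.
  by rewrite gt_eqF // powR_gt0.
have GB m : `|G m 1 - 1| <= B * (3 / 4) ^+ m.
  pose dG (t : R) := (residual m).[t] * Y.[t] `^ (- al - 1).
  have der (t : R) : t \in `]0, 1[%R -> is_derive t 1 (G m) (dG t).
    by move=> /itvP t01; apply: G_derive; rewrite !t01.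
  have cont : {within `[0, 1], continuous (G m)}.
    apply: derivable_within_continuous => t; rewrite in_itv /= => t01.
    by have [] := G_derive m t01.
  have [c c01 E] := MVT ltr01 der cont.
  rewrite -{2}(G0 m) E subr0 mulr1 normrM -[leRHS]mulr1.
  have c01' : 0 <= c <= 1 by rewrite !(itvP c01).
  apply: ler_pM => //; first exact: residual_le.
  rewrite ger0_norm ?powR_ge0 // -opprD powRN invf_le1 ?powR_gt0 ?Y_gt0 //.
  by have := @ler_powR _ _ (Yge1 c01') 0 (al + 1); rewrite powRr0; apply; rewrite addr_ge0.
have cG : (fun m => G m 1) @ \oo --> (1 : R).
  have : `|3 / 4 : R| < 1 by rewrite ger0_norm; lra.
  move=> /(cvg_geometric B) /cvgrPdist_le cB.
  apply/cvgrPdist_le => e /cB; apply: filterS => m /=.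
  rewrite sub0r normrN distrC => ge; apply: (le_trans (GB m)).
  exact: le_trans (ler_norm _) ge.
have Y1 : 0 < Y.[1] `^ al by rewrite powR_gt0 // Y_gt0 // ler01 lexx.
have -> : (fun m => (partial_poly m).[1]) = (fun m => G m 1 * Y.[1] `^ al).
  by apply/funext => m; rewrite /G powRN divfK // gt_eqF.
by rewrite -[X in _ --> X]mul1r; apply: cvgMl.
Qed.

Lemma powcoef_series_cvg : series c @ \oo --> Y.[1] `^ al.
Proof.
rewrite -cvg_shiftS; apply: cvg_trans partial_poly_cvg; apply: near_eq_cvg.
apply: nearW => m /=; rewrite /partial_poly horner_poly /series /= big_mkord.
by apply: eq_bigr => i _; rewrite expr1n mulr1.
Qed.

End PowerOfPolynomial.

(** * Analyticity of powers of a homogeneous polynomial *)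

Lemma prod_mixed (R : comNzRingType) N (S : {set 'I_N}) (u v : R) :
  \prod_j mixed S (fun=> u) (fun=> v) j = u ^+ #|S| * v ^+ (N - #|S|).
Proof.
rewrite (bigID (mem S)) /=; congr (_ * _).
  by rewrite -prodr_const; apply: eq_bigr => j; rewrite /mixed => ->.
have -> : (N - #|S|)%N = #|[predC S]| by rewrite -{1}(card_ord N) -(cardC S) addKn.
by rewrite -prodr_const; apply: eq_bigr => j; rewrite /mixed => /negbTE ->.
Qed.

Section TaylorParts.
Context {R : realType} {X : completeNormedModType R} {N : nat}.
Variable A : {ptws 'I_N -> X} -> R.
Hypotheses (linA : multilinear A) (contA : continuous A).

Definition taylor_part (x : X) (i : nat) (h : X) : R :=
  \sum_(S : {set 'I_N} | #|S| == i) A (mixed S (fun=> h) (fun=> x)).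

Lemma homogeneous_taylor_part x i :
  continuous_homogeneous_polynomial i (taylor_part x i).
Proof. by apply: homogeneous_sum => S /eqP <-; exact: homogeneous_mixed. Qed.

Lemma taylor_part0 x h : taylor_part x 0 h = A (fun=> x).
Proof.
rewrite /taylor_part (eq_bigl (pred1 (finset.set0 : {set 'I_N}))).
  rewrite big_pred1_eq; congr A.
  by apply/funext => j; rewrite /mixed inE.
by move=> S; rewrite cards_eq0.
Qed.

Lemma taylor_expansion x (t : R) h :
  A (fun=> t *: h + x) = \sum_(i < N.+1) taylor_part x i h * t ^+ i.
Proof.
rewrite (multilinearD (multilinear_slotwise linA)).
rewrite (partition_big (fun S : {set 'I_N} => inord #|S| : 'I_N.+1) xpredT) //=.
apply: eq_bigr => i _; rewrite /taylor_part mulr_suml.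
have cS (S : {set 'I_N}) : (#|S| < N.+1)%N by rewrite ltnS -[leqRHS]card_ord max_card.
rewrite (eq_bigl (fun S : {set 'I_N} => #|S| == i)) => [|S]; last first.
  by rewrite -val_eqE /= inordK.
apply: eq_bigr => S /eqP Si.
have -> : mixed S (fun=> t *: h) (fun=> x) =
    fun j => mixed S (fun=> t) (fun=> 1) j *: mixed S (fun=> h) (fun=> x) j.
  by apply/funext => j; rewrite /mixed; case: ifP; rewrite ?scale1r.
rewrite (multilinearZ (multilinear_slotwise linA)) prod_mixed Si expr1n mulr1.
exact: mulrC.
Qed.

(** A uniform bound on the ball of radius [r], rather than one in terms of
    [|h|], because [multilinear_bounded] requires positive radii. *)
Lemma taylor_part_le x : exists2 K : R, 0 < K &
  forall (r : R) (h : X) i, 0 < r -> `|h| <= r -> `|taylor_part x i h| <= K * r ^+ i.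
Proof.
have [C C0 AC] := multilinear_bounded linA contA.
pose M := 1 + `|x|; have M1 : 1 <= M by rewrite lerDl.
exists (#|{set 'I_N}|%:R * (C * M ^+ N)) => [|r h i r0 hr].
  rewrite !mulr_gt0 ?exprn_gt0 // ?(lt_le_trans _ M1) // ltr0n.
  by apply/card_gt0P; exists finset.set0.
apply: (le_trans (ler_norm_sum _ _ _)).
rewrite -mulrA mulr_natl -sumr_const big_mkcond /=; apply: ler_sum => S _.
case: eqP => [Si|_]; last first.
  by rewrite !mulr_ge0 ?exprn_ge0 ?(ltW C0) ?(ltW r0) // (le_trans _ M1).
apply: (le_trans (AC _ (mixed S (fun=> r) (fun=> M)) _ _)).
- by move=> j; rewrite /mixed; case: ifP => // _; rewrite (lt_le_trans _ M1).
- by move=> j; rewrite /mixed; case: ifP => // _; rewrite /M lerDr.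
rewrite prod_mixed Si -mulrA ler_pM2l // mulrC ler_pM2r ?exprn_gt0 //.
by rewrite ler_weXn2l // leq_subr.
Qed.

End TaylorParts.

Section Analyticity.
Context {R : realType} {X : completeNormedModType R}.

Lemma real_analyticB (f : X -> R) (c : R) :
  real_analytic f -> real_analytic (fun x => f x - c).
Proof.
move=> fa x; have [P [r [r0 homP cP]]] := fa x.
exists (fun k h => P k h + (if k == 0%N then - c else 0)), r; split => //.
  move=> k; apply: homogeneousD => //.
  by case: k => [|k]; [exact: homogeneous_cst|exact: homogeneous0].
move=> h /cP; rewrite -cvg_shiftS => cPh; rewrite -cvg_shiftS.
have -> : [sequence (series (fun k => P k h + (if k == 0%N then - c else 0)) n.+1)]_n =
    (fun n => series (fun k => P k h) n.+1 + - c).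
  apply/funext => n; rewrite /series /= big_split /=; congr (_ + _).
  by rewrite big_mkord big_ord_recl /= big1 ?addr0.
by apply: cvgD => //; exact: cvg_cst.
Qed.

Lemma homogeneous_powcoef (al a : R) (p : X -> nat -> R) :
  (forall i, continuous_homogeneous_polynomial i (fun h => p h i)) ->
  forall k, continuous_homogeneous_polynomial k (fun h => powcoef al a (p h) k).
Proof.
move=> pP k; have [m] := ubnP k; elim: m => // m IH in k *; rewrite ltnS => km.
case: k => [|k] in km *; first exact: homogeneous_cst.
under eq_fun do rewrite powcoefS.
apply: (@homogeneousM _ _ 0 k.+1); first exact: homogeneous_cst.
apply: homogeneous_sum => j _; apply: (@homogeneousM _ _ 0 k.+1); first exact: homogeneous_cst.
rewrite -{1}(subnK (ltnW (ltn_ord j))); apply: homogeneousM; first exact: pP.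
by apply: IH; rewrite (leq_trans (ltn_ord j)).
Qed.

(** [Y h] is the polynomial [t |-> 1 + q (x + t h)].  The radius [r] is such that
    [K r ^ i <= a / 4 ^ i] for all [i > 0], where [K] is the bound of
    [taylor_part_le] and [a = 1 + q x] the constant coefficient: as
    [a / (K + a) <= 1], the case [i = 1] is the worst one. *)
Lemma power_analytic (al : R) N (q : X -> R) : 0 <= al <= 1 ->
  continuous_homogeneous_polynomial N q -> (forall x, 0 <= q x) ->
  real_analytic (fun x => (1 + q x) `^ al).
Proof.
move=> /andP[al0 al1] [A [lA cA qA]] q0 x.
have [K K0 partK] := taylor_part_le lA cA x.
pose a := 1 + q x; have a1 : 1 <= a by rewrite lerDl.
have a0 : 0 < a by rewrite (lt_le_trans _ a1).
pose coef h i := taylor_part A x i h + (i == 0%N)%:R.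
pose Y h : {poly R} := \poly_(i < N.+1) coef h i.
have Y0 h : (Y h)`_0 = a.
  by rewrite coef_poly /= /coef taylor_part0 eqxx -qA addrC.
have YE h t : (Y h).[t] = 1 + q (t *: h + x).
  rewrite horner_poly qA taylor_expansion // -[X in X + _](expr0 t).
  rewrite [in RHS]big_ord_recl big_ord_recl /coef /= addrA; congr (_ + _).
    by rewrite !expr0 !mulr1 addrC.
  by apply: eq_bigr => i _; rewrite addr0.
have coefP i : continuous_homogeneous_polynomial i (fun h => (Y h)`_i).
  under eq_fun do rewrite coef_poly.
  case: (boolP (i < N.+1)%N) => _; last exact: homogeneous0.
  apply: homogeneousD; first exact: homogeneous_taylor_part.
  by case: i => [|i]; [exact: homogeneous_cst|exact: homogeneous0].
pose r := a / (4 * (K + a)).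
have Ka : 0 < K + a by rewrite addr_gt0.
have r0 : 0 < r by rewrite divr_gt0 // mulr_gt0.
exists (fun k h => powcoef al a (nth 0 (Y h)) k), r; split => //.
  exact: homogeneous_powcoef.
move=> h hr; have -> : (1 + q (x + h)) `^ al = (Y h).[1] `^ al.
  by rewrite YE scale1r [h + x]addrC.
rewrite -(Y0 h); apply: powcoef_series_cvg => //; rewrite ?Y0 //.
  case=> [|i]; first by rewrite Y0 expr0 divr1 ger0_norm // ltW.
  rewrite coef_poly; case: ifP => _; last by rewrite normr0 divr_ge0 ?exprn_ge0 // ltW.
  rewrite /coef addr0; apply: (le_trans (partK r h i.+1 r0 (ltW hr))).
  have -> : r = a / (K + a) / 4 by rewrite /r invfM mulrA mulrAC.
  rewrite expr_div_n mulrA ler_pM2r ?invr_gt0 ?exprn_gt0 //.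
  have s0 : 0 <= a / (K + a) by rewrite divr_ge0 // ltW.
  have s1 : a / (K + a) <= 1 by rewrite ler_pdivrMr // mul1r lerDr ltW.
  apply: (@le_trans _ _ (K * (a / (K + a)))).
    by rewrite ler_pM2l // exprS ler_piMr // exprn_ile1.
  by rewrite mulrCA ler_piMr ?(ltW a0) // ler_pdivrMr // mul1r lerDl ltW.
by move=> t _; rewrite YE lerDl.
Qed.

End Analyticity.

(** * The principal root on the right half-plane *)

Section ComplexRoot.
Context {R : realType}.
Implicit Types (a b : R[i]) (t : R).

Lemma normr_normc a : `|a| = (normc a)%:C.
Proof. by rewrite normc_def; case: a. Qed.

Lemma normc_ge0 a : 0 <= normc a.
Proof. by case: a => x y; exact: sqrtr_ge0. Qed.

Lemma Re_le_normc a : complex.Re a <= normc a.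
Proof.
case: a => x y; rewrite /normc /=; apply: (le_trans (ler_norm x)).
by rewrite -sqrtr_sqr ler_sqrt ?lerDl ?sqr_ge0 // addr_ge0 ?sqr_ge0.
Qed.

Lemma normc_gt0 a : 0 < complex.Re a -> 0 < normc a.
Proof. by move=> /lt_le_trans; apply; exact: Re_le_normc. Qed.

Lemma normcX a k : normc (a ^+ k) = normc a ^+ k.
Proof. by elim: k => [|k IH]; rewrite ?expr0 ?normc1 // !exprS normcM IH. Qed.

Lemma normc_real (x : R) : normc x%:C = `|x|.
Proof. by rewrite /normc /= expr0n /= addr0 sqrtr_sqr. Qed.

Definition expi t : R[i] := cos t +i* sin t.

Lemma expiD s t : expi (s + t) = expi s * expi t.
Proof.
by rewrite /expi cosD sinD; simpc; congr (_ +i* _); rewrite addrC.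
Qed.

Lemma expiX t k : expi t ^+ k = expi (k%:R * t).
Proof.
elim: k => [|k IH]; first by rewrite mul0r /expi cos0 sin0.
by rewrite exprS IH -expiD -[in RHS]natr1 mulrDl mul1r addrC.
Qed.

Lemma normc_expi t : normc (expi t) = 1.
Proof. by rewrite /normc /= cos2Dsin2 sqrtr1. Qed.

(** The principal argument, on the right half-plane only. *)
Definition carg a : R := atan (complex.Im a / complex.Re a).

Definition croot (N : nat) a : R[i] :=
  (normc a `^ N%:R^-1)%:C * expi (carg a / N%:R).

Lemma polar a : 0 < complex.Re a -> a = (normc a)%:C * expi (carg a).
Proof.
case: a => x y /= x0; rewrite /normc /expi /carg /=.
set v := y / x.
have c0 : cos (atan v) != 0 by rewrite cos_atan gt_eqF // invr_gt0 sqrtr_gt0 ltr_wpDr ?sqr_ge0.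
have sE : sin (atan v) = v * cos (atan v) by rewrite -{2}[v]atanK /tan divfK.
have nE : Num.sqrt (x ^+ 2 + y ^+ 2) * cos (atan v) = x.
  have -> : x ^+ 2 + y ^+ 2 = x ^+ 2 * (1 + v ^+ 2).
    by rewrite /v; field; rewrite gt_eqF.
  rewrite sqrtrM ?sqr_ge0 // sqrtr_sqr gtr0_norm // cos_atan mulfK //.
  by rewrite gt_eqF // sqrtr_gt0 ltr_wpDr ?sqr_ge0.
simpc; rewrite sE mulrCA nE; congr (_ +i* _).
by rewrite /v divfK // gt_eqF.
Qed.

Section Order.
Variable N : nat.
Hypothesis N0 : (0 < N)%N.

Let Nr : (0 : R) < N%:R. Proof. by rewrite ltr0n. Qed.

Lemma powR_rootK (x : R) : 0 <= x -> (x `^ N%:R^-1) ^+ N = x.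
Proof.
by move=> x0; rewrite -powR_mulrn ?powR_ge0 // -powRrM mulVf ?gt_eqF // powRr1.
Qed.

Lemma crootK a : 0 < complex.Re a -> croot N a ^+ N = a.
Proof.
move=> a0; rewrite /croot exprMn -rmorphXn /= powR_rootK ?normc_ge0 // expiX.
by rewrite [N%:R * _]mulrC divfK ?gt_eqF // -polar.
Qed.

Lemma croot_real (x : R) : croot N x%:C = (`|x| `^ N%:R^-1)%:C.
Proof.
rewrite /croot normc_real /carg /= mul0r atan0 mul0r.
by rewrite /expi cos0 sin0 mulr1.
Qed.

Lemma normc_croot a : normc (croot N a) = normc a `^ N%:R^-1.
Proof. by rewrite normcM normc_expi mulr1 normc_real ger0_norm ?powR_ge0. Qed.

Lemma normc_croot_ge a (s : R) : 0 <= s -> s ^+ N <= normc a -> s <= normc (croot N a).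
Proof.
move=> s0 sa; rewrite -(ler_pXn2r N0) ?nnegrE ?normc_ge0 //.
by rewrite normc_croot powR_rootK ?normc_ge0.
Qed.

(** The arguments of two points of the right half-plane are less than [pi / 2]
    in absolute value, so a product of [N - 1] of their principal [N]-th roots
    has an argument of absolute value less than [(N - 1) / N * (pi / 2)]; this
    is the cosine of that bound. *)
Definition root_margin : R := cos (N.-1%:R / N%:R * (pi / 2)).

Let angle_bound : 0 <= N.-1%:R / N%:R * (pi / 2 : R) < pi / 2.
Proof.
have p0 := pi_gt0 R; apply/andP; split.
  by rewrite !mulr_ge0 ?invr_ge0 // ltW.
rewrite -[ltRHS]mul1r ltr_pM2r ?divr_gt0 // ltr_pdivrMr // mul1r ltr_nat.
by move: N0; lia.
Qed.

Lemma root_margin_gt0 : 0 < root_margin.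
Proof.
have p0 := pi_gt0 R; have /andP[b0 b1] := angle_bound.
by apply: cos_gt0_pihalf; rewrite b1 andbT; lra.
Qed.

Lemma root_marginP t : `|t| <= N.-1%:R / N%:R * (pi / 2) -> root_margin <= cos t.
Proof.
have p0 := pi_gt0 R; have /andP[b0 b1] := angle_bound.
move=> tb; have -> : cos t = cos `|t|.
  by case: (ger0P t) => _; rewrite ?cosN.
rewrite /root_margin leNgt ltr_cos -?leNgt // in_itv /= ?b0 ?normr_ge0 /=; lra.
Qed.

Definition root_sum a b : R[i] :=
  \sum_(i < N) croot N a ^+ (N.-1 - i) * croot N b ^+ i.

Lemma root_sumE a b : 0 < complex.Re a -> 0 < complex.Re b ->
  a - b = (croot N a - croot N b) * root_sum a b.
Proof. by move=> a0 b0; rewrite -subrXX !crootK. Qed.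

Lemma carg_lt a : `|carg a| < pi / 2.
Proof. by rewrite ltr_norml /carg atan_gtNpi2 atan_ltpi2. Qed.

(** The real parts of the terms are all nonnegative, since their arguments are
    in the sector described by [root_margin]; the first term alone gives the
    bound. *)
Lemma root_sum_ge a b :
  root_margin * normc (croot N a) ^+ N.-1 <= normc (root_sum a b).
Proof.
have p0 := pi_gt0 R.
have termE i : (i < N)%N ->
    complex.Re (croot N a ^+ (N.-1 - i) * croot N b ^+ i) =
    normc (croot N a) ^+ (N.-1 - i) * normc (croot N b) ^+ i *
    cos ((N.-1 - i)%:R * (carg a / N%:R) + i%:R * (carg b / N%:R)).
  move=> iN; rewrite !normc_croot /croot !exprMn !expiX -!rmorphXn.
  by rewrite mulrACA -expiD -rmorphM /=; simpc.
have cosE i : (i < N)%N -> root_margin <=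
    cos ((N.-1 - i)%:R * (carg a / N%:R) + i%:R * (carg b / N%:R)).
  move=> iN; apply: root_marginP.
  apply: (le_trans (ler_normD _ _)); rewrite !normrM !normfV !normr_nat.
  have -> : N.-1%:R / N%:R * (pi / 2) = (N.-1 - i)%:R * (pi / 2 / N%:R) +
      i%:R * (pi / 2 / N%:R) :> R.
    rewrite -mulrDl -natrD subnK; last by move: iN; lia.
    by rewrite mulrA mulrAC.
  by apply: lerD; rewrite ler_wpM2l // ler_wpM2r ?invr_ge0 // ltW // carg_lt.
apply: le_trans (Re_le_normc _); rewrite /root_sum raddf_sum /=.
case: (N) N0 termE cosE => // k _ termE cosE.
rewrite big_ord_recl /= termE // subn0 expr0 mulr1 -[leLHS]addr0; apply: lerD.
  rewrite mulrC ler_wpM2l ?exprn_ge0 ?normc_ge0 //.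
  by have := cosE 0%N isT; rewrite subn0.
apply: sumr_ge0 => i _; rewrite termE ?lift0 ?ltnS //.
rewrite !mulr_ge0 ?exprn_ge0 ?normc_ge0 //.
by apply: (le_trans (ltW root_margin_gt0)); apply: cosE; rewrite ltnS.
Qed.

End Order.
End ComplexRoot.

Lemma gt0_complexE (R : realType) (e : R[i]) : 0 < e -> exists2 d : R, 0 < d & e = d%:C.
Proof.
case: e => x y; rewrite ltcE /= => /andP[/eqP -> x0].
by exists x.
Qed.

Lemma cvg_sum_powers (K : numFieldType) (T : Type) (F : set_system T)
    {FF : Filter F} (u : T -> K) (l : K) (n : nat) (k : nat -> nat) (c : nat -> K) :
  u @ F --> l ->
  (\sum_(i < n) u x ^+ k i * c i) @[x --> F] --> \sum_(i < n) l ^+ k i * c i.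
Proof.
move=> ul; apply: (@cvg_big K 'I_n +%R 0 xpredT (@add_continuous K) T F
  (index_enum _) (fun i x => u x ^+ k i * c i) (fun i => l ^+ k i * c i)) => i _.
apply: cvgMl; elim: (k i) => [|m IH]; first exact: cvg_cst.
by under eq_fun do rewrite exprS; rewrite exprS; exact: cvgM.
Qed.

Section ComplexRootDerivable.
Context {R : realType} {N : nat}.
Hypothesis N0 : (0 < N)%N.
Implicit Types a b : R[i]^o.

Lemma normc_croot_gt0 a : 0 < complex.Re a -> 0 < normc (croot N a).
Proof. by move=> a0; rewrite normc_croot powR_gt0 // normc_gt0. Qed.

Lemma croot_dist a b : 0 < complex.Re a -> 0 < complex.Re b ->
  root_margin N * normc (croot N a) ^+ N.-1 * normc (croot N a - croot N b) <=
  normc (a - b).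
Proof.
move=> a0 b0; rewrite (root_sumE N0 a0 b0) [leRHS]normcM [leRHS]mulrC.
by rewrite ler_wpM2r ?normc_ge0 // root_sum_ge.
Qed.

Lemma near_Re_gt0 a : 0 < complex.Re a -> \forall b \near a, 0 < complex.Re b.
Proof.
move=> a0; apply/nbhs_ballP; exists (complex.Re a)%:C => /=; first by rewrite ltcR.
move=> b; rewrite /ball /= normr_normc ltcR => ab.
have := Re_le_normc (a - b); move: ab; case: a {a0} => x y; case: b => x' y' /=.
by lra.
Qed.

Lemma croot_continuous a : 0 < complex.Re a ->
  {for a, continuous (croot N : R[i]^o -> R[i]^o)}.
Proof.
move=> a0; apply/(@cvgrPdist_le _ _ _ (nbhs a) (nbhs_filter a)) => e /gt0_complexE[d d0 ->].
have m0 : 0 < root_margin N * normc (croot N a) ^+ N.-1.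
  by rewrite mulr_gt0 ?root_margin_gt0 // exprn_gt0 // normc_croot_gt0.
have e0 : (0 : R[i]) < (root_margin N * normc (croot N a) ^+ N.-1 * d)%:C.
  by rewrite ltcR mulr_gt0.
near=> b; rewrite normr_normc lecR -(ler_pM2l m0).
apply: (le_trans (croot_dist a0 _)); first by near: b; exact: near_Re_gt0.
rewrite -lecR -normr_normc.
near: b; apply/nbhs_ballP.
by exists (root_margin N * normc (croot N a) ^+ N.-1 * d)%:C => //= b; exact: ltW.
Unshelve. all: by end_near. Qed.

(** The difference quotient at [a] is the inverse of [root_sum (a + h) a], which
    is continuous in [h] and nonzero at [h = 0]. *)
Lemma croot_derivable a : 0 < complex.Re a ->
  derivable (croot N : R[i]^o -> R[i]^o) a 1.
Proof.
move=> a0.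
pose S (b : R[i]^o) : R[i]^o := root_sum N b a.
have cS : {for a, continuous S}.
  exact: (@cvg_sum_powers R[i] _ _ _ _ _ _ (fun i => N.-1 - i)%N
    (fun i => croot N a ^+ i) (croot_continuous a0)).
have S0 : S a != 0.
  have : 0 < normc (S a).
    apply: lt_le_trans (root_sum_ge N0 a a).
    by rewrite mulr_gt0 ?root_margin_gt0 // exprn_gt0 // normc_croot_gt0.
  by apply: contraTneq => ->; rewrite normc0 ltxx.
have shift : (h *: (1 : R[i]^o) + a) @[h --> (0 : R[i]^o)^'] --> a.
  rewrite -[X in _ --> X]add0r -[X in _ --> X + _](scale0r (1 : R[i]^o)).
  apply: cvgD; last exact: cvg_cst.
  by apply: cvgZ; [exact: cvg_within|exact: cvg_cst].
apply: (cvgP (S a)^-1); apply: cvg_trans (cvgV S0 (cvg_comp _ _ shift cS)).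
apply: near_eq_cvg; near=> h.
have h0 : h != 0 by near: h; exact: nbhs_dnbhs_neq.
have Re0 : 0 < complex.Re (h *: (1 : R[i]^o) + a).
  by near: h; exact: (shift _ (near_Re_gt0 a0)).
have := root_sumE N0 Re0 a0; rewrite addrK.
set u := croot _ _ - _; set s := root_sum _ _ _ => hE.
have {hE} hE : h = u * s by rewrite -hE [RHS]mulr1.
have u0 : u != 0 by apply: contra_neq h0 => u0; rewrite hE u0 mul0r.
have -> : h^-1 *: u = h^-1 * u by [].
have -> : h^-1 = (u * s)^-1 by congr (_^-1).
by rewrite invfM mulrAC mulVf // mul1r.
Unshelve. all: by end_near. Qed.

End ComplexRootDerivable.

(** * The complexified polynomial *)

Lemma differentiable_quadratic (K : numFieldType) (V W : normedModType K)
    (f : V -> W) (x : V) (L : {linear V -> W}) (c : K) : 0 < c ->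
  (forall h, `|h| <= 1 -> `|L h| <= c) ->
  (forall h, `|h| <= 1 -> `|f (h + x) - (f x + L h)| <= c * `|h| ^+ 2) ->
  differentiable f x.
Proof.
move=> c0 Lb fb.
have cL : continuous L.
  apply/linear_bounded_continuous/ex_bound; exists c.
  apply/nbhs_norm0P; exists 1 => //= h /ltW; exact: Lb.
have fo : f \o shift x = cst (f x) + (L : V -> W) +o_ 0 id.
  apply/eqaddoP => e e0.
  have r1 : 1 <= 1 + c / e by rewrite lerDl divr_ge0 // ltW.
  have r0 : 0 < 1 + c / e := lt_le_trans ltr01 r1.
  (* A radius r <= 1 with c * r <= e. *)
  apply/nbhs_norm0P; exists (1 + c / e)^-1 => /= [|h hr]; first by rewrite invr_gt0.
  have h1 : `|h| <= 1 by rewrite (le_trans (ltW hr)) // invf_le1.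
  apply: (le_trans (fb h h1)); rewrite expr2 mulrA ler_wpM2r //.
  apply: (@le_trans _ _ (c * (1 + c / e)^-1)); first by rewrite ler_wpM2l ?(ltW c0) // ltW.
  by rewrite ler_pdivrMr // mulrDr mulr1 mulrCA divff ?gt_eqF // mulr1 lerDr ltW.
have dE := diff_unique cL fo.
by apply/diff_locallyP; rewrite dE.
Qed.

(** The complex linearity of [complexified] in one slot, for a pair of terms
    that differ only by the use of the real or of the imaginary part there. *)
Lemma complex_pair_linear (R : realType) (c u : R[i]) (a b a' b' : R) :
  u * (complex.Re c * a + - complex.Im c * b + a')%:C +
  'i%C * u * (complex.Im c * a + complex.Re c * b + b')%:C =
  c * (u * a%:C + 'i%C * u * b%:C) + (u * a'%:C + 'i%C * u * b'%:C).
Proof.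
case: c u => [c1 c2] [u1 u2]; apply/eqP; rewrite eq_complex /=.
by apply/andP; split; apply/eqP; ring.
Qed.

Section Complexified.
Context {R : realType} {X : completeNormedModType R} {N : nat}.
Local Notation Xc := (complexification X).
Variable A : {ptws 'I_N -> X} -> R.
Hypotheses (linA : multilinear A) (contA : continuous A).

(** The expansion of [A (x_1 + i y_1, ..., x_N + i y_N)] into real and imaginary
    parts, where [w j = (x_j, y_j)] stands for [x_j + i y_j]. *)
Definition complexified (w : 'I_N -> Xc) : R[i]^o :=
  \sum_(S : {set 'I_N})
    'i%C ^+ #|S| * (A (mixed S (fun j => (w j).2) (fun j => (w j).1)))%:C.

(** A set [S] not containing slot [i] is paired with [i |: S]: together they
    contribute [u (phi x + 'i phi y)] with [phi] real linear, which is complex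
    linear in [x + 'i y]. *)
Lemma complexified_linear : slotwise_linear complexified.
Proof.
move=> i v c z z'; rewrite /complexified.
have splitS (F : {set 'I_N} -> R[i]) : \sum_(S : {set 'I_N}) F S =
    \sum_(S : {set 'I_N} | S \subset (~: [set i])%SET) (F S + F (i |: S)%SET).
  rewrite -sum_subsets_setU1 ?inE ?eqxx // finset.setUCr.
  by apply: eq_bigl => S; rewrite finset.subsetT.
rewrite 3!splitS scaler_sumr -big_split /=; apply: eq_bigr => S SD.
have iS : i \notin S.
  by apply/negP => /(fintype.subsetP SD); rewrite !inE eqxx.
pose m := mixed S (fun j => (v j).2) (fun j => (v j).1).
have E1 (x : Xc) : mixed S (fun j => (slot v i x j).2) (fun j => (slot v i x j).1) =
    slot m i x.1.
  apply/funext => j; rewrite /m /mixed /slot.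
  by case: (eqVneq j i) => [->|//]; rewrite (negbTE iS).
have E2 (x : Xc) : mixed (i |: S)%SET (fun j => (slot v i x j).2)
    (fun j => (slot v i x j).1) = slot m i x.2.
  rewrite mixed_setU1 E1; apply/funext => j.
  by rewrite /slot eqxx; case: eqVneq.
rewrite !E1 !E2 cardsU1 iS /= exprS.
have lA := multilinear_slotwise linA.
rewrite /= -scaleNr !(slotD lA, slotZ lA).
exact: complex_pair_linear.
Qed.

Definition complex_ext (z : Xc) : R[i]^o := complexified (fun=> z).

Lemma complex_ext_complexify x : complex_ext (complexify x) = (A (fun=> x))%:C.
Proof.
rewrite /complex_ext /complexified (bigD1 finset.set0) //= big1 ?addr0.
  rewrite cards0 expr0 mul1r; congr (A _)%:C.
  by apply/funext => j; rewrite /mixed inE.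
move=> S; rewrite -card_gt0 => /card_gt0P[j jS].
have -> : mixed S (fun=> 0) (fun=> x) = slot (mixed S (fun=> 0) (fun=> x)) j 0.
  by apply/funext => l; rewrite /slot /mixed; case: eqVneq => // ->; rewrite jS.
by rewrite (slot0 (multilinear_slotwise linA)) mulr0.
Qed.

Lemma normc_sum (I : finType) (F : I -> R[i]) :
  normc (\sum_i F i) <= \sum_i normc (F i).
Proof.
elim/big_ind2: _ => [|a r b s ar bs|//]; first by rewrite normc0.
by apply: (le_trans (le_normcD _ _)); exact: lerD.
Qed.

Lemma complexified_bounded : exists2 C : R, 0 < C &
  forall (w : 'I_N -> Xc) (M : 'I_N -> R), (forall j, 0 < M j) ->
    (forall j, taylor_norm (w j) <= M j) -> normc (complexified w) <= C * \prod_j M j.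
Proof.
have [C C0 AC] := multilinear_bounded linA contA.
exists (#|{set 'I_N}|%:R * C) => [|w M M0 wM].
  by rewrite mulr_gt0 // ltr0n; apply/card_gt0P; exists finset.set0.
apply: (le_trans (normc_sum _)).
rewrite -mulrA mulr_natl -sumr_const; apply: ler_sum => S _.
rewrite normcM normcX normc_real.
have -> : normc ('i%C : R[i]) = 1 by rewrite /normc /= expr0n expr1n add0r sqrtr1.
rewrite expr1n mul1r; apply: AC => // j; apply: le_trans (wM j).
rewrite /mixed; case: ifP => _.
  have := @Defs.taylor_norm_ub _ _ (w j) 0 (-1).
  by rewrite scale0r sub0r -scaleNr opprK scale1r expr0n sqrrN expr1n add0r; apply.
have := @Defs.taylor_norm_ub _ _ (w j) 1 0.
by rewrite scale0r subr0 scale1r expr0n expr1n addr0; apply.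
Qed.

Lemma complexification_normE (z : Xc) : `|z| = (taylor_norm z)%:C.
Proof. by []. Qed.

Lemma complex_extD z h : complex_ext (h + z) =
  \sum_(S : {set 'I_N}) complexified (mixed S (fun=> h) (fun=> z)).
Proof. exact: (multilinearD complexified_linear (fun=> h) (fun=> z)). Qed.

Lemma complexified_set0 z h :
  complexified (mixed finset.set0 (fun=> h) (fun=> z)) = complex_ext z.
Proof. by congr complexified; apply/funext => j; rewrite /mixed inE. Qed.

(** Every term of the expansion other than the constant one contains [h]. *)
Lemma complex_ext_dist : exists2 C : R, 0 < C & forall (z h : Xc) (M : R),
  0 < M -> taylor_norm z <= M -> taylor_norm h <= M ->
  normc (complex_ext (h + z) - complex_ext z) <= C * taylor_norm h * M ^+ N.-1.
Proof.
have [C C0 wC] := complexified_bounded.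
have card0 : 0 < #|{set 'I_N}|%:R :> R.
  by rewrite ltr0n; apply/card_gt0P; exists finset.set0.
exists (#|{set 'I_N}|%:R * C) => [|z h M M0 zM hM]; first by rewrite mulr_gt0.
have [->|h0] := eqVneq h 0.
  by rewrite add0r subrr normc0 !mulr_ge0 ?exprn_ge0 ?Defs.taylor_norm_ge0 // ltW.
have h_gt0 : 0 < taylor_norm h by rewrite -ltcR -complexification_normE normr_gt0.
rewrite complex_extD (bigD1 finset.set0) //= complexified_set0 addrAC subrr add0r.
rewrite big_mkcond /=; apply: (le_trans (normc_sum _)).
rewrite -!mulrA mulr_natl -sumr_const; apply: ler_sum => S _.
case: ifP => [|_]; last first.
  by rewrite normc0 !mulr_ge0 ?exprn_ge0 // ltW.
rewrite -card_gt0 => S0.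
apply: (le_trans (wC _ (mixed S (fun=> taylor_norm h) (fun=> M)) _ _)).
- by move=> j; rewrite /mixed; case: ifP.
- by move=> j; rewrite /mixed; case: ifP.
rewrite prod_mixed ler_pM2l // -{1}(prednK S0) exprS -mulrA ler_pM2l //.
have SN : (#|S| <= N)%N by rewrite -[leqRHS]card_ord max_card.
have -> : (N.-1 = #|S|.-1 + (N - #|S|))%N by lia.
by rewrite exprD ler_wpM2r ?exprn_ge0 ?(ltW M0) // lerXn2r ?nnegrE // ltW.
Qed.

(** The derivative is the sum of the terms of the expansion containing [h] once;
    the terms containing it at least twice are of order [|h| ^ 2]. *)
Lemma complex_ext_differentiable (z : Xc) : differentiable complex_ext z.
Proof.
have [C C0 wC] := complexified_bounded.
pose M := 1 + taylor_norm z; have M1 : 1 <= M by rewrite lerDl Defs.taylor_norm_ge0.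
have M0 : 0 < M by rewrite (lt_le_trans _ M1).
have termb (S : {set 'I_N}) h k : (0 < k <= #|S|)%N -> taylor_norm h <= 1 ->
    normc (complexified (mixed S (fun=> h) (fun=> z))) <=
    C * (taylor_norm h ^+ k * M ^+ N).
  move=> /andP[k0 kS] h1; have [h_eq0|h0] := eqVneq h 0.
    have /card_gt0P[j jS] : (0 < #|S|)%N by rewrite (leq_trans k0).
    have -> : mixed S (fun=> h) (fun=> z) = slot (mixed S (fun=> h) (fun=> z)) j 0.
      by apply/funext => l; rewrite /slot /mixed; case: eqVneq => // ->; rewrite jS.
    rewrite (slot0 complexified_linear) normc0.
    by rewrite !mulr_ge0 ?exprn_ge0 ?Defs.taylor_norm_ge0 // ltW.
  have h_gt0 : 0 < taylor_norm h by rewrite -ltcR -complexification_normE normr_gt0.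
  apply: (le_trans (wC _ (mixed S (fun=> taylor_norm h) (fun=> M)) _ _)).
  - by move=> j; rewrite /mixed; case: ifP.
  - by move=> j; rewrite /mixed; case: ifP => // _; rewrite lerDr.
  rewrite prod_mixed ler_pM2l //; apply: ler_pM; rewrite ?exprn_ge0 ?(ltW M0) ?(ltW h_gt0) //.
    by rewrite ler_wiXn2l // ltW.
  by rewrite ler_weXn2l // leq_subr.
pose L (h : Xc) : R[i]^o :=
  \sum_(S : {set 'I_N} | #|S| == 1%N) complexified (mixed S (fun=> h) (fun=> z)).
have linL : linear L.
  move=> c h h'; rewrite /L scaler_sumr -big_split /=; apply: eq_bigr => S /cards1P[j ->].
  have E y : mixed [set j]%SET (fun=> y) (fun=> z) = slot (fun=> z) j y.
    by apply/funext => l; rewrite /mixed inE.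
  by rewrite !E complexified_linear.
pose Llin : {linear Xc -> R[i]^o} :=
  HB.pack L (@GRing.isLinear.Build _ _ _ _ L linL).
have card0 : 0 < #|{set 'I_N}|%:R :> R.
  by rewrite ltr0n; apply/card_gt0P; exists finset.set0.
pose D := #|{set 'I_N}|%:R * (C * M ^+ N).
have D0 : 0 < D by rewrite !mulr_gt0 ?exprn_gt0.
have sumb (P : pred {set 'I_N}) h k : (0 < k)%N -> taylor_norm h <= 1 ->
    (forall S, P S -> (k <= #|S|)%N) ->
    normc (\sum_(S | P S) complexified (mixed S (fun=> h) (fun=> z))) <=
    D * taylor_norm h ^+ k.
  move=> k0 h1 PS; rewrite big_mkcond /=; apply: (le_trans (normc_sum _)).
  rewrite -!mulrA mulr_natl -sumr_const; apply: ler_sum => S _.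
  case: ifP => [/PS kS|_]; first by rewrite [M ^+ N * _]mulrC; apply: termb; rewrite ?k0.
  by rewrite normc0 !mulr_ge0 ?exprn_ge0 ?Defs.taylor_norm_ge0 ?(ltW C0) ?(ltW M0).
apply: (@differentiable_quadratic _ _ _ _ _ Llin D%:C); first by rewrite ltcR.
- move=> h; rewrite complexification_normE lecR => h1; rewrite normr_normc lecR.
  apply: (le_trans (sumb _ h 1%N isT h1 _)); first by move=> S /eqP ->.
  by rewrite expr1 ler_piMr // ltW.
- move=> h; rewrite complexification_normE lecR => h1.
  rewrite normr_normc -rmorphXn -rmorphM lecR.
  rewrite complex_extD (bigD1 finset.set0) //= complexified_set0.
  rewrite (bigID (fun S : {set 'I_N} => #|S| == 1%N)) /=.
  have -> : \sum_(S : {set 'I_N} | (S != finset.set0) && (#|S| == 1%N))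
      complexified (mixed S (fun=> h) (fun=> z)) = L h.
    apply: eq_bigl => S; rewrite -card_gt0.
    by case: eqP => [->|]; rewrite ?andbF.
  have cancel (u v w : R[i]) : u + (v + w) - (u + v) = w by ring.
  rewrite [X in normc X]cancel; apply: sumb => // S.
  by rewrite -card_gt0; case: #|S| => [|[|k]].
Qed.

End Complexified.

(** * The extension to a strip *)

Section Strip.
Context {R : realType} {X : completeNormedModType R}.
Local Notation Xc := (complexification X).

Lemma taylor_norm_complexify (x : X) : taylor_norm (complexify x) = `|x|.
Proof.
apply: le_anti; apply/andP; split.
  apply: Defs.taylor_norm_le => u v uv /=; rewrite scaler0 subr0 normrZ.
  by rewrite ler_piMl // -(@ler_pXn2r _ 2) ?nnegrE // expr1n real_normK ?num_real //;
    have := sqr_ge0 v; lra.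
have := @Defs.taylor_norm_ub _ _ (complexify x) 1 0.
by rewrite /= scaler0 subr0 scale1r expr0n expr1n addr0; apply.
Qed.

Lemma taylor_normD (z w : Xc) : taylor_norm (z + w) <= taylor_norm z + taylor_norm w.
Proof. by have := ler_normD z w; rewrite !complexification_normE -rmorphD lecR. Qed.

Lemma taylor_normN (z : Xc) : taylor_norm (- z) = taylor_norm z.
Proof. by have /(congr1 (@complex.Re R)) := normrN z. Qed.

Lemma stripP (delta : R) (w : Xc) : strip delta w <->
  exists (x : X) (z : Xc), taylor_norm z < delta /\ w = z + complexify x.
Proof.
split=> -[x [z [zd ->]]]; exists x, z; split; rewrite 1?addrC //.
  by rewrite -ltcR.
by rewrite complexification_normE ltcR.
Qed.

Lemma strip_complexify (delta : R) (x : X) : 0 < delta -> strip delta (complexify x).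
Proof.
move=> d0; exists x, 0; rewrite normr0 addr0; split => //.
by rewrite ltcR.
Qed.

Lemma open_strip (delta : R) : open (strip delta : set Xc).
Proof.
rewrite openE => _ [x [z [zd ->]]]; apply/nbhs_normP => /=.
exists (delta%:C - `|z|) => /=; first by rewrite subr_gt0.
move=> w /= wd; exists x, (z + (w - (complexify x + z))); split.
  apply: (le_lt_trans (ler_normD _ _)); rewrite -ltrBrDl.
  by rewrite distrC.
by rewrite addrA subrKC.
Qed.

Lemma expr1D_le (t : R) N : 0 <= t -> (1 + t) ^+ N <= 2 ^+ N * (1 + t ^+ N).
Proof.
move=> t0; have tN : 0 <= t ^+ N by rewrite exprn_ge0.
have twoN : 0 <= (2 : R) ^+ N by rewrite exprn_ge0.
have [t1|t1] := leP t 1.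
  apply: (@le_trans _ _ (2 ^+ N)); last by rewrite ler_peMr // lerDl.
  by apply: lerXn2r; rewrite ?nnegrE //; lra.
apply: (@le_trans _ _ ((2 * t) ^+ N)).
  by apply: lerXn2r; rewrite ?nnegrE //; lra.
by rewrite exprMn ler_wpM2l // lerDr.
Qed.

Variables (N : nat) (q : X -> R).
Hypotheses (N0 : (0 < N)%N).
Hypothesis qP : continuous_homogeneous_polynomial N q.
Hypothesis q_ge : forall x, `|x| ^+ N <= q x.

(** [B = C 2 ^ N] bounds [|f (x + z) - q x| / (|z| (1 + q x))] for [|z| <= 1], and
    [delta] makes this quotient times [|z|] at most one half.  The Lipschitz
    estimate is proved with [w] the larger of the two points, so that
    [M = 2 (1 + |w|)] bounds both [|w|] and [|w' - w|]. *)
Lemma holomorphic_root_extension : exists delta : R, exists L : R,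
  exists G : Xc -> R[i]^o, [/\ 0 < delta, 0 < L,
    forall x, G (complexify x) = ((1 + q x) `^ N%:R^-1)%:C,
    holomorphic_on (strip delta) G &
    forall w w', strip delta w -> strip delta w' ->
      normc (G w - G w') <= L * taylor_norm (w - w')].
Proof.
have [A [lA cA qA]] := qP.
have [C C0 distC] := complex_ext_dist lA cA.
pose f : Xc -> R[i]^o := complex_ext A.
have f_real x : f (complexify x) = (q x)%:C by rewrite /f complex_ext_complexify // qA.
have q0 x : 0 <= q x by apply: le_trans (q_ge x); rewrite exprn_ge0.
pose B := C * 2 ^+ N; have B0 : 0 < B by rewrite mulr_gt0 ?exprn_gt0.
pose delta := (2 * (B + 1))^-1; have d0 : 0 < delta by rewrite invr_gt0; lra.
have d1 : delta <= 1 by rewrite invf_le1; lra.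
have dB : B * delta <= 2^-1.
  rewrite /delta ler_pdivrMr; last by lra.
  by lra.
have near_real x z : taylor_norm z < delta ->
    normc (f (z + complexify x) - (q x)%:C) <= 2^-1 * (1 + q x).
  move=> zd; rewrite -f_real.
  have x0 : 0 <= `|x| by [].
  have M1 : 1 <= 1 + `|x| by lra.
  have M0 : 0 < 1 + `|x| by lra.
  apply: (le_trans (distC _ _ _ M0 _ _)).
  - by rewrite taylor_norm_complexify lerDr.
  - by rewrite (le_trans (ltW zd)) // (le_trans d1).
  have : (1 + `|x|) ^+ N.-1 <= 2 ^+ N * (1 + q x).
    apply: (@le_trans _ _ ((1 + `|x|) ^+ N)); first by rewrite ler_weXn2l // leq_pred.
    apply: (le_trans (expr1D_le N x0)); rewrite ler_wpM2l ?exprn_ge0 //.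
    by rewrite lerD2l.
  move=> Mq; apply: (@le_trans _ _ (C * delta * (2 ^+ N * (1 + q x)))).
    apply: ler_pM; [|by rewrite exprn_ge0 // ltW| |exact: Mq].
      by rewrite mulr_ge0 ?Defs.taylor_norm_ge0 // ltW.
    by rewrite ler_wpM2l // ltW.
  have -> : C * delta * (2 ^+ N * (1 + q x)) = B * delta * (1 + q x).
    by rewrite /B; ring.
  by rewrite ler_wpM2r // addr_ge0.
have strip_est w : strip delta w -> 0 < complex.Re (1 + f w) /\
    (8^-1 * (1 + taylor_norm w)) ^+ N <= normc (1 + f w).
  move=> /stripP[x [z [zd ->]]]; set w' := z + _.
  have near := near_real x z zd.
  have half_le : 2^-1 * (1 + q x) <= complex.Re (1 + f w').
    have := Re_le_normc (- (f w' - (q x)%:C)).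
    rewrite -(normcN (f w' - _)) in near => /le_trans/(_ near).
    rewrite !raddfB !raddfD /=; case: (f w') => a b /=; lra.
  split; first by apply: lt_le_trans half_le; have := q0 x; lra.
  apply: le_trans (Re_le_normc _); apply: le_trans half_le.
  have wx : 1 + taylor_norm w' <= 2 * (1 + `|x|).
    have := taylor_normD z (complexify x); rewrite taylor_norm_complexify.
    by have := normr_ge0 x; move: zd d1; rewrite /w'; lra.
  apply: (@le_trans _ _ (4^-1 ^+ N * (2 ^+ N * (1 + q x)))).
    apply: (@le_trans _ _ ((4^-1 * (1 + `|x|)) ^+ N)).
      apply: lerXn2r; rewrite ?nnegrE ?mulr_ge0 ?addr_ge0 ?Defs.taylor_norm_ge0 //.
      by move: wx; lra.
    rewrite exprMn ler_wpM2l ?exprn_ge0 //.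
    apply: (le_trans (expr1D_le N (normr_ge0 x))).
    by rewrite ler_wpM2l ?exprn_ge0 // lerD2l.
  rewrite mulrA -exprMn ler_wpM2r ?addr_ge0 //.
  have -> : 4^-1 * 2 = 2^-1 :> R by lra.
  by rewrite -[leRHS]expr1 ler_wiXn2l //; lra.
pose kappa : R := root_margin N.
have k0 : 0 < kappa := root_margin_gt0 N0.
pose G w : R[i]^o := croot N (1 + f w).
pose L := C * 16 ^+ N.-1 / kappa.
have L0 : 0 < L by rewrite !mulr_gt0 ?exprn_gt0 ?invr_gt0.
have lip w w' : strip delta w -> strip delta w' -> taylor_norm w' <= taylor_norm w ->
    normc (G w - G w') <= L * taylor_norm (w - w').
  move=> /strip_est[Rw aw] /strip_est[Rw' _] ww'.
  have t0 : 0 <= taylor_norm w := Defs.taylor_norm_ge0 w.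
  pose M := 2 * (1 + taylor_norm w); have M0 : 0 < M by rewrite /M; lra.
  have root_ge : 16^-1 * M <= normc (G w).
    apply: (normc_croot_ge N0); first by rewrite mulr_ge0 // ltW.
    by have -> : 16^-1 * M = 8^-1 * (1 + taylor_norm w) by rewrite /M; lra.
  have diffM : taylor_norm (w' - w) <= M.
    by have := taylor_normD w' (- w); rewrite taylor_normN /M; lra.
  have wM : taylor_norm w <= M by rewrite /M; lra.
  have := distC _ _ _ M0 wM diffM; rewrite subrK => fdist.
  have := croot_dist N0 Rw Rw'.
  have -> : 1 + f w - (1 + f w') = - (f w' - f w) by ring.
  rewrite normcN => /le_trans/(_ fdist) H.
  have MN : 0 < (16^-1 * M) ^+ N.-1 by rewrite exprn_gt0 // mulr_gt0.
  have -> : taylor_norm (w - w') = taylor_norm (w' - w).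
    by rewrite -taylor_normN opprB.
  rewrite -(ler_pM2l (mulr_gt0 k0 MN)).
  have -> : kappa * (16^-1 * M) ^+ N.-1 * (L * taylor_norm (w' - w)) =
      C * taylor_norm (w' - w) * M ^+ N.-1.
    rewrite /L exprMn exprVn; field.
    by rewrite gt_eqF //= expf_neq0.
  apply: le_trans H; rewrite ler_wpM2r ?normc_ge0 // ler_wpM2l ?(ltW k0) //.
  by apply: lerXn2r; rewrite ?nnegrE ?normc_ge0 // mulr_ge0 // ltW.
exists delta, L, G; split; [exact: d0|exact: L0| | |].
- move=> x; rewrite /G f_real.
  have -> : 1 + (q x)%:C = (1 + q x)%:C by rewrite rmorphD.
  rewrite croot_real ger0_norm //.
  by rewrite addr_ge0.
- split; first exact: open_strip.
  move=> w /strip_est[Rw _].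
  apply: (@differentiable_comp _ _ _ _ (fun w => 1 + f w) (croot N : R[i]^o -> R[i]^o)).
    by apply: differentiableD => //; exact: complex_ext_differentiable.
  by apply/derivable1_diffP; exact: croot_derivable.
- move=> w w' sw sw'; have [ww'|/ltW ww'] := leP (taylor_norm w') (taylor_norm w).
    exact: lip.
  rewrite -normcN opprB -[taylor_norm (w - w')]taylor_normN opprB.
  exact: lip.
Qed.

End Strip.

Lemma bounded_lipschitz (K : numFieldType) (V W : normedModType K) (f : V -> W)
    (A : set V) (k : K) : A !=set0 ->
  (forall x y, A x -> A y -> `|f x - f y| <= k * `|x - y|) ->
  [lipschitz f x | x in A].
Proof.
move=> [a Aa] fk.
have PF : ProperFilter (globally (A `*` A)) by exact: (globally_properfilter (a := (a, a))).
by apply: (@klipschitzW _ _ _ k) => -[x y] [/= Ax Ay]; exact: fk.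
Qed.

Theorem lemma2 (R : realType) (X : completeNormedModType R) (n : nat) (K : R)
    (q : X -> R) :
  (1 <= n)%N -> 1 < K ->
  (forall x, 0 <= q x) ->
  continuous_homogeneous_polynomial (2 * n) q ->
  (forall x, `|x| ^+ (2 * n) <= q x <= K * `|x| ^+ (2 * n)) ->
  let Q : X -> R := fun x => (1 + q x) `^ ((2 * n)%:R^-1) - 1 in
  (forall x, 0 <= Q x) /\
  real_analytic Q /\
  (0%:E < ereal_inf [set (Q x)%:E | x in [set x : X | (1 <= `|x|)%R]])%E /\
  Q 0 = 0 /\
  [lipschitz Q x | x in [set: X]] /\
  (exists delta : R, 0 < delta /\
     exists Qc : complexification X -> R[i]^o,
       [/\ forall x : X, Qc (complexify x) = (Q x)%:C,
           holomorphic_on (strip delta) Qc &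
           [lipschitz Qc z | z in strip delta]]) /\
  (forall (r : R) (x : X), 1 <= r -> Q x < 4 * r -> `|x| < 8 * r) /\
  (forall x : X, 8 <= `|x| -> 2^-1 * `|x| <= Q x) /\
  separating Q.
Proof.
move=> n1 K1 q0.
have : (0 < 2 * n)%N by rewrite muln_gt0.
move: (2 * n)%N => N N0 qP qb Q.
have q_ge x : `|x| ^+ N <= q x by have /andP[] := qb x.
have Nr0 : (0 : R) < N%:R^-1 by rewrite invr_gt0 ltr0n.
have Nr1 : N%:R^-1 <= 1 :> R by rewrite invf_le1 ?ler1n ?ltr0n.
have Q_ge0 x : 0 <= Q x.
  have q1 : 1 <= 1 + q x by rewrite lerDl.
  by have := ler_powR q1 (ltW Nr0); rewrite powRr0 subr_ge0.
have Q_ge x : `|x| - 1 <= Q x.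
  rewrite lerD2r; have {1}-> : `|x| = (`|x| ^+ N) `^ N%:R^-1.
    by rewrite -powR_mulrn // -powRrM divff ?powRr1 // pnatr_eq0 -lt0n.
  apply: ge0_ler_powR; rewrite ?nnegrE ?exprn_ge0 ?addr_ge0 ?(ltW Nr0) //.
  by rewrite (le_trans (q_ge x)) // lerDr.
have Q0 : Q 0 = 0.
  have -> : Q 0 = (1 + q 0) `^ N%:R^-1 - 1 by [].
  have -> : q 0 = 0.
    apply: le_anti; rewrite q0 andbT; have /andP[_] := qb 0.
    by rewrite normr0 expr0n eqn0Ngt N0 mulr0.
  by rewrite addr0 powR1 subrr.
have half_le x : 8 <= `|x| -> 2^-1 * `|x| <= Q x.
  by move=> x8; have := Q_ge x; lra.
have [delta [L [G [d0 L0 G_real G_hol G_lip]]]] := holomorphic_root_extension N0 qP q_ge.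
split=> //; split.
  by apply: (real_analyticB _ (power_analytic _ qP q0)); rewrite ltW.
split.
  have : (0 : R) < 2 `^ N%:R^-1 - 1.
    have two1 : (1 : R) < 2 by lra.
    by have := gt0_ltr_powR Nr0 ler01 (ler0n _ 2) two1; rewrite powR1 subr_gt0.
  rewrite -lte_fin => /lt_le_trans; apply.
  apply/ereal_infP => _ [x /= x1 <-]; rewrite lee_fin lerD2r.
  apply: ge0_ler_powR; rewrite ?nnegrE ?addr_ge0 ?(ltW Nr0) //.
  have : 1 <= `|x| ^+ N by rewrite exprn_ege1.
  by have := q_ge x; lra.
split=> //; split.
  apply: (@bounded_lipschitz _ _ _ _ _ L); first by exists 0.
  move=> x y _ _.
  have := G_lip (complexify x) (complexify y) (strip_complexify _ d0) (strip_complexify _ d0).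
  rewrite !G_real -rmorphB normc_real.
  have -> : complexify x - complexify y = complexify (x - y).
    by rewrite /complexify; congr pair; rewrite /= subr0.
  rewrite taylor_norm_complexify.
  by have -> : Q x - Q y = (1 + q x) `^ N%:R^-1 - (1 + q y) `^ N%:R^-1 by rewrite /Q; ring.
split.
  exists delta; split => //; exists (fun z => G z - 1); split.
  - by move=> x; rewrite G_real rmorphB.
  - case: G_hol => oS dG; split; first exact: oS.
    move=> z /dG dGz.
    by apply: differentiableB => //; exact: differentiable_cst.
  - apply: (@bounded_lipschitz _ _ _ _ _ L%:C).
      by exists (complexify 0); exact: strip_complexify.
    move=> z w zS wS; rewrite opprB addrA subrK.
    by rewrite normr_normc complexification_normE -rmorphM lecR; exact: G_lip.
split.
  by move=> r x r1 Qr; have := Q_ge x; lra.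
split=> //; split => //; exists 8, 2^-1; split => //.
Qed.
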